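(* Let $1\le m_1,m_2\le K$ be integers with $m_1+m_2\le K$. Assume that for each $k\in[K]$ and $(i,i')\in\{(0,1),(1,0)\}$, $\int\log(f_i^k/f_{i'}^k)f_i^k\,d\mu^k>0$ and $\int[\log(f_i^k/f_{i'}^k)]^2f_i^k\,d\mu^k<\infty$. Let $\alpha,\beta\in(0,1)$ satisfy $C^{-1}\alpha\le\beta\le C\alpha$ for some absolute constant $C>0$, and let $$a_{\alpha,\beta}=|\log\beta|+\log\Bigl[2^{m_2}\binom{K}{m_2}\Bigr],\qquad b_{\alpha,\beta}=|\log\alpha|+\log\Bigl[2^{m_1}\binom{K}{m_1}\Bigr].$$ Then the Leap rule $\{\delta_L(a_{\alpha,\beta},b_{\alpha,\beta})\}$ is second-order asymptotically optimal in $\{\Delta_{m_1,m_2}^{\mathrm{gfr}}(\alpha,\beta)\}$ as $\alpha,\beta\to0$ (under the constraint $C^{-1}\alpha\le\beta\le C\alpha$), that is, for each $A\subset[K]$, $$\limsup_{\alpha,\beta\to0}\Bigl(\mathbb E_A[T_L(a_{\alpha,\beta},b_{\alpha,\beta})]-T_A^{\min}\bigl(\Delta_{m_1,m_2}^{\mathrm{gfr}}(\alpha,\beta)\bigr)\Bigr)<\infty.$$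
   Context: $K\ge2$, $[K]=\{1,\dots,K\}$. For each $k\in[K]$, $\mu^k$ is a $\sigma$-finite measure on a measurable space $\mathcal X^k$ and $f_0^k,f_1^k$ are probability densities with respect to $\mu^k$. One observes $K$ independent streams $\{\mathbf X_t^k:t\ge1\}$, each i.i.d. For $A\subset[K]$, $\mathbb P_A$ (expectation $\mathbb E_A$) is the law under which the streams are independent and stream $k$ is i.i.d. with density $f_1^k$ if $k\in A$ and $f_0^k$ if $k\notin A$. $\mathcal F_t$ is the $\sigma$-field generated by all observations from all streams up to time $t$. Here $\mathcal A=2^{[K]}$. A sequential procedure is a pair $(T,D)$ with $T$ an $\{\mathcal F_t\}_{t\ge1}$-stopping time and $D$ an $\mathcal F_T$-measurable decision with values in $\mathcal A$; $\Delta$ is the class of all such procedures. For $\Delta'\subset\Delta$, $T_A^{\min}(\Delta')=\inf_{(T,D)\in\Delta'}\mathbb E_A[T]$. The class controlling generalized familywise error rates is $$\Delta_{m_1,m_2}^{\mathrm{gfr}}(\alpha,\beta)=\Bigl\{(T,D)\in\Delta:\max_{A\subset[K]}\mathbb P_A(|D\setminus A|\ge m_1)\le\alpha,\ \max_{A\subset[K]}\mathbb P_A(|A\setminus D|\ge m_2)\le\beta\Bigr\}.$$ Log-likelihood ratios: $\lambda_t^k=\sum_{s=1}^t\log\frac{f_1^k(\mathbf X_s^k)}{f_0^k(\mathbf X_s^k)}$. Let $p(t)$ be the number of strictly positive $\lambda_t^k$, $k\in[K]$. Let $\hat\lambda_t^{(1)}\le\cdots\le\hat\lambda_t^{(p(t))}$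 be the ordered values of the positive $\lambda_t^k$, with stream indices $\hat\ell_1(t),\dots,\hat\ell_{p(t)}(t)$, and let $\check\lambda_t^{(1)}\le\cdots\le\check\lambda_t^{(K-p(t))}$ be the ordered absolute values of the nonpositive $\lambda_t^k$, with stream indices $\check\ell_1(t),\dots,\check\ell_{K-p(t)}(t)$. Convention: $\hat\lambda_t^{(j)}=\infty$ for $j>p(t)$ and $\check\lambda_t^{(j)}=\infty$ for $j>K-p(t)$. For $a,b>0$ and $i=0,\dots,m_1-1$ let $$\hat\tau_i=\min\Bigl\{t\ge1:\sum_{j=1}^{m_1-i}\hat\lambda_t^{(j)}\ge b,\ \sum_{j=i+1}^{i+m_2}\check\lambda_t^{(j)}\ge a\Bigr\},\quad\hat D_i=\{k:\lambda_{\hat\tau_i}^k>0\}\cup\{\check\ell_1(\hat\tau_i),\dots,\check\ell_i(\hat\tau_i)\},$$ and for $i=1,\dots,m_2-1$ let $$\check\tau_i=\min\Bigl\{t\ge1:\sum_{j=i+1}^{i+m_1}\hat\lambda_t^{(j)}\ge b,\ \sum_{j=1}^{m_2-i}\check\lambda_t^{(j)}\ge a\Bigr\},\quad\check D_i=\{k:\lambda_{\check\tau_i}^k>0\}\setminus\{\hat\ell_1(\check\tau_i),\dots,\hat\ell_i(\check\tau_i)\}$$ (nonexistent indices being omitted from the listed sets). The Leap rule $\delta_L(a,b)=(T_L(a,b),D_L(a,b))$ has $T_L(a,b)=\min\{\hat\tau_0,\dots,\hat\tau_{m_1-1},\check\tau_1,\dots,\check\tau_{m_2-1}\}$, and $D_L(a,b)$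 is the decision $\hat D_i$ or $\check D_i$ of the stopping time attaining the minimum (the union of the corresponding decisions if several attain it). It is known from earlier work that $\delta_L(a_{\alpha,\beta},b_{\alpha,\beta})\in\Delta_{m_1,m_2}^{\mathrm{gfr}}(\alpha,\beta)$. *)

(* Defs.v *)
From HB Require Import structures.
From mathcomp Require Import all_boot all_order all_algebra finmap.
From mathcomp Require Import all_classical all_reals all_analysis.
Import Order.TTheory GRing.Theory Num.Theory.
Import numFieldNormedType.Exports.

Set Implicit Arguments.
Unset Strict Implicit.
Unset Printing Implicit Defensive.

Local Open Scope classical_set_scope.
Local Open Scope ring_scope.
Local Open Scope ereal_scope.

(** Random times take values in [option nat], with [None] for infinity. *)

Definition time_ereal (R : realType) (o : option nat) : \bar R :=
  if o is Some t then t%:R%:E else +oo.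

Definition time_le (o : option nat) (t : nat) : bool :=
  if o is Some s then (s <= t)%N else false.

Definition time_min (o1 o2 : option nat) : option nat :=
  match o1, o2 with
  | Some s, Some t => Some (minn s t)
  | Some s, None => Some s
  | None, o => o
  end.

(** min {t >= 1 : E t}, with min of the empty set equal to infinity. *)
Definition first_time (E : nat -> bool) : option nat :=
  if pselect (exists t, (0 < t)%N && E t) is left h then Some (ex_minn h)
  else None.

(** Densities and log-likelihood ratios. *)

Definition is_density (R : realType) (d : measure_display)
    (S : measurableType d) (mu : set S -> \bar R) (f : S -> R) : Prop :=
  [/\ measurable_fun [set: S] f, (forall x, 0 <= f x)%R
    & \int[mu]_x (f x)%:E = 1].

(** log (f / g), extended-real valued: the division and the logarithm are those
    of [\bar R], so the value is +oo where f > 0 = g, and -oo where f = 0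
    (in particular where f = g = 0, which has probability zero under both
    densities and where the products with f below vanish since -oo * 0 = 0). *)
Definition llr (R : realType) (S : Type) (f g : S -> R) (x : S) : \bar R :=
  lne ((f x)%:E / (g x)%:E).

(** The observation model. The observation of stream [k] at time [s.+1] is
    [X k s], and [f k true], [f k false] are the densities f_1^k, f_0^k.
    All the laws live on one measurable space carrying the observations. *)

Definition iid_streams (R : realType) (K : nat) (d : 'I_K -> measure_display)
    (S : forall k, measurableType (d k))
    (mu : forall k, {sigma_finite_measure set (S k) -> \bar R})
    (f : forall k, bool -> S k -> R)
    (dO : measure_display) (Omega : measurableType dO)
    (P : {set 'I_K} -> probability Omega R)
    (X : forall k, nat -> Omega -> S k) : Prop :=
  [/\ forall k s, measurable_fun [set: Omega] (X k s),
      forall (A : {set 'I_K}) k s (B : set (S k)), measurable B ->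
        P A (X k s @^-1` B) = \int[mu k]_(x in B) (f k (k \in A) x)%:E
    & forall (A : {set 'I_K}) (J : {fset 'I_K * nat})
        (B : forall k, nat -> set (S k)),
        (forall k s, measurable (B k s)) ->
        P A (\bigcap_(j in [set` J]) (X j.1 j.2 @^-1` B j.1 j.2)) =
        \big[mule/1]_(j <- J) P A (X j.1 j.2 @^-1` B j.1 j.2)].

(** F_t: generated by the observations of all streams up to time t. *)
Definition filtration (K : nat) (d : 'I_K -> measure_display)
    (S : forall k, measurableType (d k)) (Omega : Type)
    (X : forall k, nat -> Omega -> S k) (t : nat) : set_system Omega :=
  <<s [set E | exists k, exists s, exists B : set (S k),
        [/\ (s < t)%N, measurable B & E = X k s @^-1` B]] >>.

Definition filtration_oo (K : nat) (d : 'I_K -> measure_display)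
    (S : forall k, measurableType (d k)) (Omega : Type)
    (X : forall k, nat -> Omega -> S k) : set_system Omega :=
  <<s \bigcup_t filtration X t >>.

(** Sequential procedures (T, D). *)

Definition procedure (K : nat) (Omega : Type) : Type :=
  ((Omega -> option nat) * (Omega -> {set 'I_K}))%type.

Definition stopping_time (K : nat) (d : 'I_K -> measure_display)
    (S : forall k, measurableType (d k)) (Omega : Type)
    (X : forall k, nat -> Omega -> S k) (T : Omega -> option nat) : Prop :=
  (forall w, T w <> Some 0%N) /\
  (forall t, (1 <= t)%N -> filtration X t [set w | time_le (T w) t]).

Definition stopped_measurable (K : nat) (d : 'I_K -> measure_display)
    (S : forall k, measurableType (d k)) (Omega : Type)
    (X : forall k, nat -> Omega -> S k) (T : Omega -> option nat)
    (D : Omega -> {set 'I_K}) : Prop :=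
  forall B : {set 'I_K},
    filtration_oo X [set w | D w = B] /\
    (forall t, (1 <= t)%N ->
       filtration X t ([set w | D w = B] `&` [set w | time_le (T w) t])).

Definition Delta (K : nat) (d : 'I_K -> measure_display)
    (S : forall k, measurableType (d k)) (Omega : Type)
    (X : forall k, nat -> Omega -> S k) : set (procedure K Omega) :=
  [set p | stopping_time X p.1 /\ stopped_measurable X p.1 p.2].

Definition Delta_gfr (R : realType) (K : nat) (d : 'I_K -> measure_display)
    (S : forall k, measurableType (d k))
    (dO : measure_display) (Omega : measurableType dO)
    (P : {set 'I_K} -> probability Omega R)
    (X : forall k, nat -> Omega -> S k) (m1 m2 : nat) (alpha beta : R) :
    set (procedure K Omega) :=
  [set p | [/\ Delta X p,
    forall A : {set 'I_K}, P A [set w | (m1 <= #|p.2 w :\: A|)%N] <= alpha%:E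
  & forall A : {set 'I_K}, P A [set w | (m2 <= #|A :\: p.2 w|)%N] <= beta%:E]].

Definition expected_time (R : realType) (dO : measure_display)
    (Omega : measurableType dO) (Q : probability Omega R)
    (T : Omega -> option nat) : \bar R :=
  \int[Q]_w time_ereal R (T w).

Definition Tmin (R : realType) (K : nat) (dO : measure_display)
    (Omega : measurableType dO) (Q : probability Omega R)
    (Dl : set (procedure K Omega)) : \bar R :=
  ereal_inf [set expected_time Q p.1 | p in Dl].

(** The Leap rule. Below, [v] is the vector of log-likelihood ratios at a given
    time and [l] is a trajectory [t |-> lambda_t]. The ordered values carry
    their 1-based indices and are infinite beyond the end of the list. *)

Definition hat_idx (R : realType) (K : nat) (v : 'I_K -> \bar R) : seq 'I_K :=
  sort (fun k k' => v k <= v k') [seq k <- enum 'I_K | 0 < v k].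

Definition check_idx (R : realType) (K : nat) (v : 'I_K -> \bar R) :
    seq 'I_K :=
  sort (fun k k' => `|v k| <= `|v k'|) [seq k <- enum 'I_K | v k <= 0].

Definition hat_val (R : realType) (K : nat) (v : 'I_K -> \bar R) (j : nat) :
    \bar R :=
  nth +oo [seq v k | k <- hat_idx v] j.-1.

Definition check_val (R : realType) (K : nat) (v : 'I_K -> \bar R) (j : nat) :
    \bar R :=
  nth +oo [seq `|v k| | k <- check_idx v] j.-1.

Definition hat_tau (R : realType) (K m1 m2 : nat) (a b : R)
    (l : nat -> 'I_K -> \bar R) (i : nat) : option nat :=
  first_time (fun t =>
    (b%:E <= \sum_(1 <= j < (m1 - i).+1) hat_val (l t) j) &&
    (a%:E <= \sum_(i.+1 <= j < (i + m2).+1) check_val (l t) j)).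

Definition check_tau (R : realType) (K m1 m2 : nat) (a b : R)
    (l : nat -> 'I_K -> \bar R) (i : nat) : option nat :=
  first_time (fun t =>
    (b%:E <= \sum_(i.+1 <= j < (i + m1).+1) hat_val (l t) j) &&
    (a%:E <= \sum_(1 <= j < (m2 - i).+1) check_val (l t) j)).

(** On an infinite stopping time the decisions are, arbitrarily, empty. *)
Definition hat_dec (R : realType) (K m1 m2 : nat) (a b : R)
    (l : nat -> 'I_K -> \bar R) (i : nat) : {set 'I_K} :=
  if hat_tau m1 m2 a b l i is Some t then
    ([set k | 0 < l t k] :|: [set k in take i (check_idx (l t))])%SET
  else finset.set0.

Definition check_dec (R : realType) (K m1 m2 : nat) (a b : R)
    (l : nat -> 'I_K -> \bar R) (i : nat) : {set 'I_K} :=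
  if check_tau m1 m2 a b l i is Some t then
    ([set k | 0 < l t k] :\: [set k in take i (hat_idx (l t))])%SET
  else finset.set0.

Definition leap_time (R : realType) (K m1 m2 : nat) (a b : R)
    (l : nat -> 'I_K -> \bar R) : option nat :=
  time_min
    (\big[time_min/None]_(0 <= i < m1) hat_tau m1 m2 a b l i)
    (\big[time_min/None]_(1 <= i < m2) check_tau m1 m2 a b l i).

Definition leap_dec (R : realType) (K m1 m2 : nat) (a b : R)
    (l : nat -> 'I_K -> \bar R) : {set 'I_K} :=
  [set k | [exists i : 'I_m1,
              (hat_tau m1 m2 a b l i == leap_time m1 m2 a b l) &&
              (k \in hat_dec m1 m2 a b l i)]
        || [exists i : 'I_m2,
              [&& (0 < i)%N,
                  check_tau m1 m2 a b l i == leap_time m1 m2 a b l &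
                  k \in check_dec m1 m2 a b l i]]]%SET.

Definition lambda (R : realType) (K : nat) (d : 'I_K -> measure_display)
    (S : forall k, measurableType (d k)) (f : forall k, bool -> S k -> R)
    (Omega : Type) (X : forall k, nat -> Omega -> S k)
    (w : Omega) (t : nat) (k : 'I_K) : \bar R :=
  \sum_(0 <= s < t) llr (f k true) (f k false) (X k s w).

Definition leap_rule (R : realType) (K : nat) (d : 'I_K -> measure_display)
    (S : forall k, measurableType (d k)) (f : forall k, bool -> S k -> R)
    (Omega : Type) (X : forall k, nat -> Omega -> S k) (m1 m2 : nat) (a b : R) :
    procedure K Omega :=
  (fun w => leap_time m1 m2 a b (lambda f X w),
   fun w => leap_dec m1 m2 a b (lambda f X w)).

(** a_{alpha,beta} (with m = m2, e = beta) and b_{alpha,beta}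
    (with m = m1, e = alpha). *)
Definition threshold (R : realType) (K m : nat) (e : R) : R :=
  (`|ln e| + ln (2 ^ m * 'C(K, m))%N%:R)%R.

(* Main.v *)
Require Import Defs.
From HB Require Import structures.
From mathcomp Require Import all_boot all_order all_algebra finmap.
From mathcomp Require Import all_classical all_reals all_analysis measurable_realfun.
From mathcomp Require Import ring lra zify.
Import Order.TTheory GRing.Theory Num.Theory.
Import numFieldNormedType.Exports.

Set Implicit Arguments.
Unset Strict Implicit.
Unset Printing Implicit Defensive.

Local Open Scope classical_set_scope.
Local Open Scope ring_scope.
Local Open Scope ereal_scope.

(** Fix A and let S^k_t be the log-likelihood ratio of stream k at time t, signed
    so that it drifts upwards under P_A. Then the likelihood ratio of P_B to P_A
    at time t is exp (- S^B_t), where S^B_t is the sum of S^k_t over the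
    symmetric difference of A and B. The whole proof is the inequality
    E_A[T_L] <= E_A[T] + constant, for every procedure (T, D) of the class and
    with a constant that depends neither on the procedure nor on alpha and beta
    ([leap_bound] and [horizon_le]).

    What the error constraints say under P_A. Let the risk of stopping at time T
    with decision D be the sum over B of exp (- S^B_T) times
    1/alpha [|D \ B| >= m1] + 1/beta [|B \ D| >= m2]. Changing the measure from
    P_A to P_B ([likelihood_le]) turns its expectation into error probabilities
    divided by alpha and beta, so it is at most 2 * 2^K ([risk_sum_le]).

    What makes the Leap rule stop. It has stopped as soon as some decision D is
    such that every B for which D would be a false positive error (resp. a false
    negative error) is less likely than the most likely set by a factor e^-b
    (resp. e^-a); this is the purely combinatorial [leap_stops]. If T stops with
    risk r and with an acceptable D, that is |D \ A| < m1 and |A \ D| < m2, then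
    these sets B satisfy S^B_T >= |log alpha| - log r (resp. |log beta| - log r).
    Hence the Leap rule stops no later than the first time at which every S^k has
    gained c0 + r since T, where c0 only accounts for the binomial constants
    ([leap_after_risk]).

    How long this takes. Finitely many walks with positive drift and finite second
    moments exceed their starting points by x simultaneously after an expected
    time that is at most affine in x. The proof is a Lyapunov argument with
    the sum of the Huber functions of the deficits: it decreases at a linear rate
    as long as one deficit is positive ([huber_drift]), and it grows only linearly
    with the deficits ([unpassed_sum]). As the risk has a bounded expectation,
    the delay of the Leap rule after T has a bounded expectation as well.

    Unacceptable decisions. They have P_A-probability at most alpha + beta. On
    that event the Leap rule is bounded by a deterministic horizon n0, of the order
    of |log alpha| + |log beta|, plus the delay of the walks after n0. This delay
    has bounded expectation by Chebyshev's inequality ([huber_tail_le]), and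
    n0 * (alpha + beta) is bounded because alpha and beta are comparable. *)

(** * The stopping region of the Leap rule *)

Lemma first_time_le (E : nat -> bool) (t : nat) :
  (0 < t)%N -> E t -> time_le (first_time E) t.
Proof.
move=> t0 Et; rewrite /first_time; case: pselect => [h|[]]; last first.
  by exists t; rewrite t0.
by rewrite /=; case: ex_minnP => s _; apply; rewrite t0.
Qed.

Lemma time_le_min (o1 o2 : option nat) (t : nat) :
  time_le (time_min o1 o2) t = time_le o1 t || time_le o2 t.
Proof. by case: o1 o2 => [s1|] [s2|] //=; rewrite ?geq_min ?orbF. Qed.

Lemma time_le_bigmin (I : eqType) (r : seq I) (F : I -> option nat) t i :
  i \in r -> time_le (F i) t -> time_le (\big[time_min/None]_(j <- r) F j) t.
Proof.
elim: r => // x r IH; rewrite inE big_cons time_le_min.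
by case/predU1P => [->|/IH h] ht; rewrite ?ht ?h ?orbT.
Qed.

Lemma subset_of_card (T : finType) (X : {set T}) (q : nat) :
  (q <= #|X|)%N -> exists2 F : {set T}, F \subset X & #|F| = q.
Proof.
move=> qX; exists [set x in take q (enum X)]%SET.
  by apply/fintype.subsetP => x; rewrite inE => /mem_take; rewrite mem_enum.
rewrite cardsE; have /card_uniqP -> : uniq (take q (enum X)).
  exact/take_uniq/enum_uniq.
by rewrite size_takel// -cardE.
Qed.

(** Trade, one at a time, an element of F outside C for an element of C outside
    F: no trade decreases the sum. *)
Lemma sum_le_exchange (R : numDomainType) (T : finType) (w : T -> R)
    (F C E : {set T}) :
  (forall k, 0 <= w k)%R -> F \subset (C :|: E)%SET -> (#|F| <= #|C|)%N ->
  (forall x y, x \in E -> y \in C -> (w x <= w y)%R) ->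
  (\sum_(k in F) w k <= \sum_(k in C) w k)%R.
Proof.
move=> w0.
elim: {F}#|F :\: C|%SET {-2}F (erefl #|F :\: C|%SET) => [|n IH] F.
  move=> /eqP; rewrite cards_eq0 finset.setD_eq0 => FC _ _ _.
  rewrite [leRHS](big_setID F) /= (finset.setIidPr FC) lerDl sumr_ge0//.
move=> cFC FCE leFC Ew.
have /card_gt0P[x xFC] : (0 < #|F :\: C|)%N by rewrite cFC.
have /card_gt0P[y yCF] : (0 < #|C :\: F|)%N.
  have := cardsID C F; have := cardsID F C; rewrite finset.setIC.
  move: cFC leFC; lia.
move: (xFC) (yCF); rewrite !inE => /andP[xC xF] /andP[yF yC].
have xE : x \in E by move/fintype.subsetP: FCE => /(_ x xF); rewrite inE (negbTE xC).
have yFx : y \notin (F :\ x)%SET by rewrite !inE (negbTE yF) andbF.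
apply: (@le_trans _ _ (\sum_(k in y |: (F :\ x)) w k)%R).
  by rewrite (big_setD1 x)//= big_setU1//= lerD2r Ew.
apply: IH => //.
- have -> : ((y |: F :\ x) :\: C = (F :\: C) :\ x)%SET.
    apply/setP => z; rewrite !inE; case: (eqVneq z y) => [->|] /=.
      by rewrite yC (negbTE yF) !andbF.
    by rewrite andbCA.
  by have := cardsD1 x (F :\: C)%SET; rewrite xFC cFC; lia.
- apply/fintype.subsetP => z; rewrite !inE => /orP[/eqP->|/andP[_ zF]].
    by rewrite yC.
  by move/fintype.subsetP: FCE => /(_ z zF); rewrite inE.
- rewrite cardsU1 yFx; have := cardsD1 x F; rewrite xF; move: leFC; lia.
Qed.

(** Sums of consecutive ordered values become sums over a set C of n streams that
    comes right after a set E of i streams of smaller weights. A range that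
    overruns the list contains the value of rank i + n, which is +oo. *)
Lemma block_sum_ge (R : realType) (K : nat) (idx : seq 'I_K)
    (w : 'I_K -> R) (wt : 'I_K -> \bar R) (i n : nat) (b : R) :
  {in idx, forall k, wt k = (w k)%:E} -> (forall k, 0 <= w k)%R -> uniq idx ->
  sorted (fun k k' => wt k <= wt k') idx -> (0 < n)%N ->
  (forall C E : {set 'I_K}, {subset C <= idx} -> {subset E <= idx} ->
     (C :&: E)%SET = finset.set0 -> #|C| = n -> #|E| = i ->
     (forall x y, x \in E -> y \in C -> (w x <= w y)%R) ->
     (b <= \sum_(k in C) w k)%R) ->
  b%:E <= \sum_(i.+1 <= j < (i + n).+1) nth +oo [seq wt k | k <- idx] j.-1.
Proof.
move=> wtE w0 uidx sidx n0 H.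
have ge0 j : 0 <= nth +oo [seq wt k | k <- idx] j.
  have [js|js] := ltnP j (size idx); last by rewrite nth_default ?size_map// leey.
  have k0 : 'I_K by case: (idx) js => // k.
  by rewrite (nth_map k0)// wtE ?mem_nth// lee_fin.
have [sz|sz] := leqP (i + n) (size idx); last first.
  have -> : \sum_(i.+1 <= j < (i + n).+1) nth +oo [seq wt k | k <- idx] j.-1 = +oo.
    rewrite big_nat_recr/=; last by lia.
    rewrite [X in _ + X]nth_default ?size_map; last by lia.
    by rewrite addeC addye// gt_eqF// (lt_le_trans (ltNy0))// sume_ge0.
  exact: leey.
have k0 : 'I_K by case: (idx) sz => [|//]; rewrite /=; lia.
set Cs := take n (drop i idx).
have uCs : uniq Cs by apply/take_uniq/drop_uniq.
have CsI : {subset Cs <= idx} by move=> x /mem_take /mem_drop.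
have -> : \sum_(i.+1 <= j < (i + n).+1) nth +oo [seq wt k | k <- idx] j.-1
        = (\sum_(k in [set k in Cs]%SET) w k)%:E.
  transitivity (\sum_(0 <= j < n) nth +oo [seq wt k | k <- idx] (i + j)).
    rewrite -[X in \sum_(X <= _ < _) _]add0n big_addn -addSn addKn.
    by apply: eq_bigr => j _; rewrite addnS addnC.
  transitivity (\sum_(k <- Cs) wt k).
    rewrite (big_nth k0) size_takel ?size_drop; last by lia.
    rewrite !big_nat; apply: eq_bigr => j jn.
    by rewrite nth_take// nth_drop (nth_map k0)//; lia.
  rewrite (eq_big_seq (fun k => (w k)%:E)); last by move=> k /CsI/wtE.
  rewrite sumEFin; congr _%:E; rewrite [RHS](eq_bigl (mem Cs)); last by move=> k; rewrite inE.
  by rewrite big_uniq.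
rewrite lee_fin; apply: (H _ [set k in take i idx]%SET).
- by move=> x; rewrite inE => /CsI.
- by move=> x; rewrite inE => /mem_take.
- apply/setP => x; rewrite !inE; apply/negP => /andP[/mem_take xd xt].
  move: uidx; rewrite -{1}(cat_take_drop i idx) cat_uniq.
  by case/and3P => _ /hasPn/(_ x xd)/=; rewrite xt.
- rewrite cardsE; move/card_uniqP: uCs => ->; rewrite size_takel//.
  rewrite size_drop -(leq_add2l i) subnKC//; apply: leq_trans sz.
  exact: leq_addr.
- rewrite cardsE; have /card_uniqP -> : uniq (take i idx) by apply: take_uniq.
  by rewrite size_takel// (leq_trans _ sz)// leq_addr.
- move=> x y; rewrite !inE => xE yC.
  rewrite -lee_fin -!wtE; [|exact: CsI|exact: mem_take xE].
  have tr : transitive (fun k k' : 'I_K => wt k <= wt k') by move=> a c d; exact: le_trans.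
  move: sidx; rewrite (sorted_pairwise tr) -{1}(cat_take_drop i idx) pairwise_cat.
  by case/andP => /allrelP/(_ x y xE (mem_take yC)).
Qed.

(** Sg is the most likely set, and the sum of |v k| over the symmetric difference
    of Sg and B is the deficit of log-likelihood of B with respect to Sg. Taking
    B = Sg \ F or B = Sg u F makes the symmetric difference equal to F, so the
    assumptions bound from below the sums of |v k| over suitable blocks F. With
    i = |D \ Sg| and i' = |Sg \ D|, these are the sums that appear in the stopping
    condition of index i - i' of the first family if i >= i', and of index i' - i
    of the second family otherwise. *)
Lemma leap_stops (R : realType) (K m1 m2 : nat) (a b : R) (v : 'I_K -> R)
    (l : nat -> 'I_K -> \bar R) (t : nat) (D : {set 'I_K}) :
  (0 < t)%N -> (0 < m1)%N -> (0 < m2)%N -> (0 < a)%R -> (0 < b)%R ->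
  (forall k, l t k = (v k)%:E) ->
  let Sg := [set k | (0 < v k)%R]%SET in
  (forall B : {set 'I_K}, (m1 <= #|D :\: B|)%N ->
     (b <= \sum_(k in (Sg :\: B) :|: (B :\: Sg)) `|v k|)%R) ->
  (forall B : {set 'I_K}, (m2 <= #|B :\: D|)%N ->
     (a <= \sum_(k in (Sg :\: B) :|: (B :\: Sg)) `|v k|)%R) ->
  time_le (leap_time m1 m2 a b l) t.
Proof.
move=> t0 m10 m20 a0 b0 lv Sg Hb Ha.
have n0 k : (0 <= `|v k|)%R by [].
have SS : (Sg :\: Sg :|: Sg :\: Sg = finset.set0)%SET by rewrite finset.setUid finset.setDv.
have i1 : (#|D :\: Sg| < m1)%N.
  rewrite ltnNge; apply/negP => /Hb; rewrite SS big_set0; lra.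
have i2 : (#|Sg :\: D| < m2)%N.
  rewrite ltnNge; apply/negP => /Ha; rewrite SS big_set0; lra.
have symB (F : {set 'I_K}) : F \subset Sg ->
    ((Sg :\: (Sg :\: F)) :|: ((Sg :\: F) :\: Sg) = F)%SET.
  move=> /fintype.subsetP FS; apply/setP => z; rewrite !inE.
  have /implyP := FS z; rewrite inE; case: (z \in F); case: (0 < v z)%R => //.
have symU (F : {set 'I_K}) : F \subset (~: Sg)%SET ->
    ((Sg :\: (Sg :|: F)) :|: ((Sg :|: F) :\: Sg) = F)%SET.
  move=> /fintype.subsetP FS; apply/setP => z; rewrite !inE.
  have /implyP := FS z; rewrite !inE; case: (z \in F); case: (0 < v z)%R => //.
have hatS : {in hat_idx (l t), forall k, k \in Sg}.
  by move=> k; rewrite mem_sort mem_filter lv lte_fin inE => /andP[].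
have checkS : {in check_idx (l t), forall k, k \in (~: Sg)%SET}.
  by move=> k; rewrite mem_sort mem_filter lv lee_fin !inE -leNgt => /andP[].
have hatwE : {in hat_idx (l t), forall k, l t k = `|v k|%:E}.
  by move=> k /hatS; rewrite inE lv => ?; rewrite gtr0_norm.
have checkwE : {in check_idx (l t), forall k, `|l t k| = `|v k|%:E}.
  by move=> k _; rewrite lv.
have hatu : uniq (hat_idx (l t)) by rewrite sort_uniq filter_uniq ?enum_uniq.
have checku : uniq (check_idx (l t)) by rewrite sort_uniq filter_uniq ?enum_uniq.
have hats : sorted (fun k k' => l t k <= l t k') (hat_idx (l t)).
  by apply: sort_sorted => x y; exact: le_total.
have checks : sorted (fun k k' => `|l t k| <= `|l t k'|) (check_idx (l t)).
  by apply: sort_sorted => x y; exact: le_total.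
have DS := cardsID Sg D; have SD := cardsID D Sg.
have cardB (F : {set 'I_K}) : F \subset Sg ->
    #|D :\: (Sg :\: F)|%SET = (#|D :\: Sg| + #|D :&: F|)%N.
  move=> FS; rewrite -cardsUI.
  have -> : ((D :\: Sg) :&: (D :&: F) = finset.set0)%SET.
    apply/setP => z; rewrite !inE; have /implyP := fintype.subsetP FS z; rewrite inE.
    by case: (z \in F); case: (0 < v z)%R; rewrite ?andbF.
  rewrite cards0 addn0; apply: eq_card => z; rewrite !inE.
  by case: (z \in F); case: (0 < v z)%R; case: (z \in D).
have cardU (F : {set 'I_K}) : F \subset (~: Sg)%SET ->
    #|(Sg :|: F) :\: D|%SET = (#|Sg :\: D| + #|F :\: D|)%N.
  move=> FS; rewrite -cardsUI.
  have -> : ((Sg :\: D) :&: (F :\: D) = finset.set0)%SET.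
    apply/setP => z; rewrite !inE; have /implyP := fintype.subsetP FS z; rewrite !inE.
    by case: (z \in F); case: (0 < v z)%R; rewrite ?andbF.
  rewrite cards0 addn0; apply: eq_card => z; rewrite !inE.
  by case: (z \in F); case: (0 < v z)%R; case: (z \in D).
have card_sub_Sg (F : {set 'I_K}) : F \subset Sg -> (#|F| <= #|D :&: F| + #|Sg :\: D|)%N.
  move=> FS; rewrite -(cardsID D F) finset.setIC leq_add2l subset_leq_card//.
  exact: finset.setSD.
have card_sub_C (F : {set 'I_K}) : F \subset (~: Sg)%SET ->
    (#|F| <= #|F :\: D| + #|D :\: Sg|)%N.
  move=> FS; rewrite -(cardsID D F) addnC leq_add2l subset_leq_card//.
  apply/fintype.subsetP => z; rewrite !inE => /andP[zF ->].
  by have := fintype.subsetP FS z zF; rewrite !inE => ->.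
rewrite /leap_time time_le_min.
have [le|lt] := leqP #|Sg :\: D|%SET #|D :\: Sg|%SET.
- apply/orP; left; set j := (#|D :\: Sg| - #|Sg :\: D|)%N.
  apply: (@time_le_bigmin _ _ _ _ j); first by rewrite mem_index_iota; lia.
  apply: first_time_le => //; apply/andP; split.
    rewrite -[(m1 - j)%N]add0n.
    apply: (@block_sum_ge _ _ _ (fun k => `|v k|)%R) => //; first by lia.
    move=> C E /= CI _ _ cC _ _.
    have CS : C \subset Sg by apply/fintype.subsetP => x /CI/hatS.
    (* at most i' of the m1 - j elements of C are outside D *)
    have := Hb (Sg :\: C)%SET; rewrite symB// cardB//; apply.
    have := card_sub_Sg _ CS; rewrite cC /j; lia.
  apply: (@block_sum_ge _ _ _ (fun k => `|v k|)%R) => //.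
  move=> C E /= CI EI dCE cC cE Ew.
  have CES : (C :|: E)%SET \subset (~: Sg)%SET.
    by apply/fintype.subsetP => x; rewrite inE => /orP[/CI|/EI]; exact: checkS.
  (* E, of size j, is made of the values skipped by the sum: at most i of the
     m2 + j elements of C u E are in D, and m2 - i' of the others are enough to
     make D a false negative error; they weigh at most as much as C *)
  have [|F] := @subset_of_card _ ((C :|: E) :\: D)%SET (m2 - #|Sg :\: D|).
    have := card_sub_C _ CES; rewrite cardsU dCE cards0 cC cE /j; lia.
  rewrite finset.subsetD => /andP[FCE dFD] cF.
  apply: (@le_trans _ _ (\sum_(k in F) `|v k|)%R); last first.
    by apply: sum_le_exchange Ew => //; rewrite cF cC leq_subr.
  have FS : F \subset (~: Sg)%SET by apply: fintype.subset_trans CES.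
  have := Ha (Sg :|: F)%SET; rewrite symU// cardU//; apply.
  by rewrite (finset.setDidPl dFD) cF; lia.
- apply/orP; right; set j := (#|Sg :\: D| - #|D :\: Sg|)%N.
  apply: (@time_le_bigmin _ _ _ _ j); first by rewrite mem_index_iota; lia.
  apply: first_time_le => //; apply/andP; split; last first.
    rewrite -[(m2 - j)%N]add0n.
    apply: (@block_sum_ge _ _ _ (fun k => `|v k|)%R) => //; first by lia.
    move=> C E /= CI _ _ cC _ _.
    have CS : C \subset (~: Sg)%SET by apply/fintype.subsetP => x /CI/checkS.
    have := Ha (Sg :|: C)%SET; rewrite symU// cardU//; apply.
    have := card_sub_C _ CS; rewrite cC /j; lia.
  apply: (@block_sum_ge _ _ _ (fun k => `|v k|)%R) => //.
  move=> C E /= CI EI dCE cC cE Ew.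
  have CES : (C :|: E)%SET \subset Sg.
    by apply/fintype.subsetP => x; rewrite inE => /orP[/CI|/EI]; exact: hatS.
  have [|F] := @subset_of_card _ (D :&: (C :|: E))%SET (m1 - #|D :\: Sg|).
    have := card_sub_Sg _ CES; rewrite cardsU dCE cards0 cC cE /j; lia.
  rewrite finset.subsetI => /andP[FD FCE] cF.
  apply: (@le_trans _ _ (\sum_(k in F) `|v k|)%R); last first.
    by apply: sum_le_exchange Ew => //; rewrite cF cC leq_subr.
  have FS : F \subset Sg by apply: fintype.subset_trans CES.
  have := Hb (Sg :\: F)%SET; rewrite symB// cardB//; apply.
  by rewrite (finset.setIidPr FD) cF; lia.
Qed.

(** * Integrals *)

Definition mfun_of d d' (aT : sigmaRingType d) (rT : sigmaRingType d') (g : aT -> rT)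
    (mg : measurable_fun setT g) : {mfun aT >-> rT} :=
  HB.pack g (isMeasurableFun.Build _ _ _ _ g mg).

Import HBNNSimple.

(** The integral of a nonnegative function is the supremum of the integrals of the
    simple functions below it. This form compares the expected leap time with the
    expectation of a measurable majorant. *)
Lemma ge0_le_integral_nomeas d (T : measurableType d) (R : realType)
    (m : {measure set T -> \bar R}) (D : set T) (f g : T -> \bar R) :
  (forall x, D x -> 0 <= f x) -> (forall x, D x -> f x <= g x) ->
  \int[m]_(x in D) f x <= \int[m]_(x in D) g x.
Proof.
move=> f0 fg; have g0 x : D x -> 0 <= g x by move=> Dx; apply: le_trans (fg x Dx); exact: f0.
rewrite [leLHS]integral_mkcond [leRHS]integral_mkcond.
rewrite !ge0_integralTE//; [|exact: erestrict_ge0|exact: erestrict_ge0].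
apply: le_ereal_sup => _ [h hf <-].
by exists h => // x; apply: le_trans (lee_restrict fg x).
Qed.

(** f agrees almost everywhere with the Radon-Nikodym derivative of nu. *)
Lemma integral_density d (T : measurableType d) (R : realType)
    (mu : {sigma_finite_measure set T -> \bar R}) (nu : {finite_measure set T -> \bar R})
    (f : T -> R) (g : T -> \bar R) :
  measurable_fun setT f -> (forall x, 0 <= f x)%R ->
  (forall B, measurable B -> nu B = \int[mu]_(x in B) (f x)%:E) ->
  measurable_fun setT g -> (forall x, 0 <= g x) ->
  \int[nu]_x g x = \int[mu]_x (g x * (f x)%:E).
Proof.
move=> mf f0 nuE mg g0.
have mfE : measurable_fun setT (EFin \o f) by exact/measurable_EFinP.
have numu : nu `<< mu.
  apply/null_content_dominatesP => A mA muA0; rewrite nuE//.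
  by apply: null_set_integral => //; exact/measurable_funTS.
have fint : mu.-integrable setT (EFin \o f).
  apply/integrableP; split=> //.
  under eq_integral => x _ do rewrite gee0_abs ?lee_fin//.
  by rewrite -nuE// ltey_eq fin_num_measure.
rewrite -(Radon_Nikodym_SigmaFinite.change_of_variables numu)//.
set dnu := Radon_Nikodym_SigmaFinite.f nu mu.
have idnu : mu.-integrable setT dnu by exact: Radon_Nikodym_SigmaFinite.f_integrable.
have mdnu := measurable_int _ idnu.
have ae : ae_eq mu setT dnu (EFin \o f).
  apply: integral_ae_eq => // E _ mE.
  by rewrite -nuE// -Radon_Nikodym_SigmaFinite.f_integral.
apply: ae_eq_integral => //.
- exact: emeasurable_funM.
- exact: emeasurable_funM.
- by apply: filterS ae => x + _ => /(_ Logic.I) ->.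
Qed.

(** * Independent observations *)

Section independence.
Context {R : realType} {I : choiceType} {d : I -> measure_display}
  {S : forall i, measurableType (d i)} {dO : measure_display}
  {Omega : measurableType dO} (P : probability Omega R)
  (X : forall i, Omega -> S i).

Definition obs_gen (J : set I) : set_system Omega :=
  [set E | exists i, exists B : set (S i),
     [/\ J i, measurable B & E = X i @^-1` B]].

Definition cylinder (J : {fset I}) (B : forall i, set (S i)) : set Omega :=
  \bigcap_(j in [set` J]) (X j @^-1` B j).

Definition cylinders (J : {fset I}) : set_system Omega :=
  [set E | exists B : forall i, set (S i), (forall i, measurable (B i)) /\ E = cylinder J B].

Hypothesis mX : forall i, measurable_fun setT (X i).
Hypothesis indep : forall (J : {fset I}) (B : forall i, set (S i)),
  (forall i, measurable (B i)) ->
  P (cylinder J B) = \big[mule/1]_(j <- J) P (X j @^-1` B j).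

Lemma measurable_obs_preimage i (B : set (S i)) : measurable B -> measurable (X i @^-1` B).
Proof. by move=> mB; rewrite -[X in measurable X]setTI; exact: mX. Qed.

Lemma measurable_obs_event J E : (<<s obs_gen J >>) E -> measurable E.
Proof.
apply: smallest_sub; first exact: sigma_algebra_measurable.
by move=> _ [i [B [_ mB ->]]]; exact: measurable_obs_preimage.
Qed.

Lemma measurable_cylinder J B : (forall i, measurable (B i)) -> measurable (cylinder J B).
Proof.
move=> mB; rewrite /cylinder bigcap_fset; apply: (@big_ind _ measurable) => //.
  exact: measurableI.
by move=> i _; exact: measurable_obs_preimage.
Qed.

Lemma setI_closed_cylinders J : setI_closed (cylinders J).
Proof.
move=> _ _ [B [mB ->]] [C [mC ->]]; exists (fun i => B i `&` C i); split.
  by move=> i; exact: measurableI.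
by rewrite /cylinder -bigcapI.
Qed.

Lemma obs_gen_cylinders (J : {fset I}) : <<s obs_gen [set` J] >> = <<s cylinders J >>.
Proof.
apply/seteqP; split.
  apply: smallest_sub; first exact: smallest_sigma_algebra.
  move=> _ [i [B [iJ mB ->]]]; apply: sub_gen_smallest.
  exists (dfwith (fun k => setT) i B); split.
    by move=> k; case: dfwithP.
  apply/seteqP; split=> [w Bw j /= jJ|w /(_ i iJ)]; last by rewrite /= dfwithin.
  by case: dfwithP.
apply: smallest_sub; first exact: smallest_sigma_algebra.
move=> _ [B [mB ->]]; rewrite /cylinder bigcap_fset big_seq.
apply: (@big_ind _ (<<s obs_gen [set` J] >>)).
- exact: (@measurableT _ (g_sigma_algebraType (obs_gen [set` J]))).
- exact: (@measurableI _ (g_sigma_algebraType (obs_gen [set` J]))).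
by move=> i iJ; apply: sub_gen_smallest; exists i; exists (B i).
Qed.

Definition obs_field (J : set I) := g_sigma_algebraType (obs_gen J).

Lemma measurable_id_obs_field J : measurable_fun setT (idfun : Omega -> obs_field J).
Proof. by move=> _ E mE; rewrite setTI preimage_id; exact: measurable_obs_event mE. Qed.

Lemma measurable_obs_coord J i : J i -> measurable_fun setT (X i : obs_field J -> S i).
Proof.
by move=> Ji _ B mB; rewrite setTI; apply: sub_gen_smallest; exists i; exists B.
Qed.

(** Independence is the product formula on cylinders, which are stable under
    intersection, and both sides are finite measures in G. *)
Lemma indep_event (J : {fset I}) i (G : set Omega) (B : set (S i)) :
  i \notin J -> (<<s obs_gen [set` J] >>) G -> measurable B ->
  P (G `&` X i @^-1` B) = P G * P (X i @^-1` B).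
Proof.
move=> iJ + mB; rewrite obs_gen_cylinders.
have mXB : measurable (X i @^-1` B) by exact: measurable_obs_preimage.
have fX E : measurable E -> P E \is a fin_num by move=> ?; exact: fin_num_measure.
move: G; apply: (@dynkin_induction _ (obs_field [set` J])).
- exact: obs_gen_cylinders.
- exact: setI_closed_cylinders.
- by rewrite setTI probability_setT mul1e.
- move=> _ [C [mC ->]].
  pose C' := dfwith C i B.
  have C'E j : j \in J -> C' j = C j.
    by move=> jJ; rewrite /C' dfwithout//; apply: contraNneq iJ => ->.
  have mC' j : measurable (C' j) by rewrite /C'; case: dfwithP.
  transitivity (P (cylinder (i |` J)%fset C')).
    congr (P _); rewrite /cylinder set_fsetU bigcap_setU setIC; congr (_ `&` _).
      by rewrite set_fset1 bigcap_set1 /C' dfwithin.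
    by apply: eq_bigcapr => j /= jJ; rewrite C'E.
  rewrite indep// big_fsetU1//= indep// /C' dfwithin muleC; congr (_ * _).
  by rewrite !big_seq; apply: eq_bigr => j jJ; rewrite -/C' C'E.
- move=> G /measurable_obs_event mG PG.
  have PG' : P ((X i @^-1` B) `&` (G : set Omega)) = P G * P (X i @^-1` B).
    by rewrite setIC; exact: PG.
  transitivity (P ((X i @^-1` B) `\` (G : set Omega))); first by rewrite setDE setIC.
  rewrite measureD//; last by rewrite ltey_eq fX.
  transitivity ((1 - P (G : set Omega)) * P (X i @^-1` B)).
    rewrite muleBl ?fX//.
    by rewrite mul1e; congr (_ - _); exact: PG'.
  by congr (_ * _); rewrite -probability_setC.
- move=> /= F mF tF PF; move: F tF PF mF => /= F tF PF mF.
  have mF' n : measurable (F n : set Omega) := measurable_obs_event (mF n).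
  have {PF}PF (n : nat) : P ((F n : set Omega) `&` X i @^-1` B)
      = P (F n : set Omega) * P (X i @^-1` B) by exact: PF.
  move: (F : (set Omega)^nat) tF mF' PF => {mF}{}F tF mF' PF.
  rewrite setI_bigcupl measure_bigcup//; last 2 first.
  + by move=> n _; exact: measurableI.
  + exact: trivIset_setIr.
  rewrite measure_bigcup// muleC -(fineK (fX _ mXB)) -nneseriesZl//.
  by apply: eq_eseriesr => n _; rewrite fineK ?fX// muleC; exact: PF.
Qed.

Definition obs_law i : probability (S i) R := distribution P (mfun_of (@mX i)).

(** By independence the pair of the past, that is the identity of Omega into the
    sigma-field of J, and of X i has a product law. Tonelli's theorem then
    integrates X i out while the past is frozen. *)
Lemma freezing (J : {fset I}) i (phi : obs_field [set` J] * S i -> \bar R) :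
  i \notin J -> measurable_fun setT phi -> (forall z, 0 <= phi z) ->
  \int[P]_w phi (w, X i w) = \int[P]_w \int[obs_law i]_x phi (w, x).
Proof.
move=> iJ mphi phi0.
pose P' := distribution P (mfun_of (@measurable_id_obs_field [set` J])).
have mj : measurable_fun setT (fun w : Omega => (w : obs_field [set` J], X i w)).
  by apply/measurable_fun_pair => //; exact: measurable_id_obs_field.
pose m' := distribution P (mfun_of mj).
transitivity (\int[m']_z phi z).
  by rewrite ge0_integral_distribution.
transitivity (\int[P' \x obs_law i]_z phi z).
  apply: eq_measure_integral => A mA _; apply/esym.
  apply: product_measure_unique => // B C mB mC.
  exact: (indep_event iJ mB mC).
rewrite fubini_tonelli1// [LHS]ge0_integral_distribution//.
  exact: measurable_fun_fubini_tonelli_F.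
by move=> y; exact: integral_ge0.
Qed.

Lemma measurable_obs_field J d' (T : sigmaRingType d') (Y : obs_field J -> T) :
  measurable_fun setT Y -> measurable_fun setT (Y : Omega -> T).
Proof. by move=> mY _ E mE; apply: (@measurable_obs_event J); exact: mY. Qed.

Lemma integral_obs_law i (g : S i -> \bar R) :
  measurable_fun setT g -> (forall x, 0 <= g x) ->
  \int[obs_law i]_x g x = \int[P]_w g (X i w).
Proof. by move=> mg g0; rewrite ge0_integral_distribution. Qed.

Lemma freezing_mul (J : {fset I}) i (Y : obs_field [set` J] -> \bar R) (g : S i -> \bar R) :
  i \notin J -> measurable_fun setT Y -> (forall w, 0 <= Y w) ->
  measurable_fun setT g -> (forall x, 0 <= g x) ->
  \int[P]_w (Y w * g (X i w)) = (\int[P]_w Y w) * \int[P]_w g (X i w).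
Proof.
move=> iJ mY Y0 mg g0.
have mYO : measurable_fun setT (Y : Omega -> \bar R).
  exact: measurable_obs_field mY.
rewrite (freezing (phi := fun z => Y z.1 * g z.2) iJ)/=.
- under eq_integral => w _ do rewrite ge0_integralZl// integral_obs_law//.
  rewrite ge0_integralZr//; exact: integral_ge0.
- apply: emeasurable_funM; exact: measurableT_comp.
- by move=> z; exact: mule_ge0.
Qed.

Lemma prod_expectation (J : {fset I}) (g : forall i, S i -> R) :
  (forall i, measurable_fun setT (g i)) -> (forall i x, 0 <= g i x)%R ->
  \int[P]_w (\prod_(j <- J) g j (X j w))%:E =
  \big[mule/1]_(j <- J) \int[P]_w (g j (X j w))%:E.
Proof.
move=> mg g0.
elim: {J}(enum_fset J) (fset_uniq J) => [_|i s IH /= /andP[si us]].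
  rewrite big_nil; under eq_integral do rewrite big_nil.
  by rewrite integral_cst//= probability_setT mule1.
rewrite big_cons -IH//.
under eq_integral => w _ do rewrite big_cons EFinM muleC.
rewrite (freezing_mul (J := [fset x in s]%fset)
  (Y := fun w => (\prod_(j <- s) g j (X j w))%:E) (g := EFin \o g i)).
- by rewrite muleC.
- by rewrite !inE.
- apply/measurable_EFinP; apply: measurable_prod => j js.
  apply: measurableT_comp => //; apply: measurable_obs_coord.
  by rewrite /= !inE.
- by move=> w; rewrite lee_fin prodr_ge0.
- exact/measurable_EFinP.
- by move=> x; rewrite lee_fin.
Qed.

End independence.

(** * Likelihood ratios as changes of measure *)

Section likelihood_ratio.
Context {R : realType} {I : choiceType} {d : I -> measure_display}
  {S : forall i, measurableType (d i)} {dO : measure_display}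
  {Omega : measurableType dO} (P Q : probability Omega R)
  (X : forall i, Omega -> S i).
Hypothesis mX : forall i, measurable_fun setT (X i).
Hypothesis indepP : forall (J : {fset I}) (B : forall i, set (S i)),
  (forall i, measurable (B i)) ->
  P (cylinder X J B) = \big[mule/1]_(j <- J) P (X j @^-1` B j).
Hypothesis indepQ : forall (J : {fset I}) (B : forall i, set (S i)),
  (forall i, measurable (B i)) ->
  Q (cylinder X J B) = \big[mule/1]_(j <- J) Q (X j @^-1` B j).
Context (ell : forall i, S i -> R) (pos : forall i, set (S i)).
Hypothesis mell : forall i, measurable_fun setT (@ell i).
Hypothesis ell0 : forall i x, (0 <= @ell i x)%R.
Hypothesis mpos : forall i, measurable (@pos i).
Hypothesis ellE : forall i (B : set (S i)), measurable B ->
  \int[P]_(w in X i @^-1` B) (@ell i (X i w))%:E = Q (X i @^-1` (B `&` @pos i)).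

(** On cylinders both sides are products of the one-coordinate identities [ellE];
    a Dynkin argument extends the equality to the generated sigma-field. The sets
    pos restrict Q to the part of it that has a density with respect to P. *)
Lemma likelihood_ratio (J : {fset I}) (G : set Omega) :
  (<<s obs_gen X [set` J] >>) G ->
  \int[P]_(w in G) (\prod_(j <- J) @ell j (X j w))%:E = Q (G `&` cylinder X J (@pos)).
Proof.
set L := fun w => (\prod_(j <- J) @ell j (X j w))%:E.
have L0 w : 0 <= L w by rewrite lee_fin prodr_ge0.
have mL : measurable_fun setT L.
  apply/measurable_EFinP; apply: measurable_prod => j _.
  exact: measurableT_comp.
have mR : measurable (cylinder X J (@pos)) := measurable_cylinder (@mX) J (@mpos).
have cylE : cylinders X J `<=` [set G | \int[P]_(w in G) L w = Q (G `&` cylinder X J (@pos))].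
  move=> _ [B [mB ->]] /=.
  rewrite /cylinder -bigcapI (@indepQ _ (fun j => B j `&` @pos j)); last first.
    by move=> i; exact: measurableI.
  rewrite integral_mkcond.
  transitivity (\int[P]_w (\prod_(j <- J) (\1_(B j) (X j w) * @ell j (X j w)))%:E).
    apply: eq_integral => w _; rewrite patchE big_split/= EFinM.
    case: ifPn => [/set_mem Bw|/negP Bw].
      rewrite big_seq big1 ?mul1e// => j jJ; rewrite indicE mem_set//.
      exact: Bw.
    suff -> : (\prod_(j <- J) \1_(B j) (X j w))%R = 0%R :> R by rewrite mul0e.
    apply/eqP; rewrite prodf_seq_eq0; apply: contra_notT Bw => /hasPn h.
    apply/mem_set => j /= /h; rewrite /= indicE.
    by case: (boolP (_ \in _)) => [/set_mem//|]; rewrite eqxx.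
  rewrite (@prod_expectation _ _ _ _ _ _ P X (@mX) (@indepP) J
    (fun j x => \1_(B j) x * @ell j x)%R).
  - apply: eq_bigr => j _; rewrite -ellE// [RHS]integral_mkcond.
    apply: eq_integral => w _; rewrite patchE indicE.
    have -> : (w \in X j @^-1` B j) = (X j w \in B j).
      by apply/idP/idP => /set_mem h; apply/mem_set.
    by case: (X j w \in B j); rewrite ?mul1r ?mul0r.
  - by move=> i; apply: measurable_funM => //; exact: measurable_indic.
  - by move=> i x; rewrite mulr_ge0.
have ET : \int[P]_w L w = Q (cylinder X J (@pos)).
  rewrite -[in RHS](setTI (cylinder X J (@pos))); apply: cylE; exists (fun=> setT); split => //.
  by apply/seteqP; split.
rewrite obs_gen_cylinders; move: G.
apply: (@dynkin_induction _ (obs_field X [set` J])).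
- exact: obs_gen_cylinders.
- exact: setI_closed_cylinders.
- by rewrite setTI.
- exact: cylE.
- move=> G /(measurable_obs_event (@mX)) mG GE; move: (G : set Omega) mG GE => {}G mG GE.
  have QGR : Q (G `&` cylinder X J (@pos)) \is a fin_num.
    by apply: fin_num_measure; exact: measurableI.
  rewrite -[LHS]/(\int[P]_(w in ~` G) L w).
  suff h : Q (G `&` cylinder X J (@pos)) + \int[P]_(w in ~` G) L w =
           Q (G `&` cylinder X J (@pos)) + Q (~` G `&` cylinder X J (@pos)).
    rewrite -[LHS](addeK _ QGR) -[RHS](addeK _ QGR); congr (_ - _).
    by rewrite addeC [RHS]addeC.
  rewrite -{1}GE -ge0_integral_setU//; [|exact: measurableC| | |].
  + rewrite setUv ET (measureDI _ mR mG) setDE addeC.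
    by congr (_ + _); congr (Q _); rewrite setIC.
  + by rewrite setUv; exact: mL.
  + by move=> w _; exact: L0.
  + by apply/disj_setPS; rewrite setICr.
- move=> F mF tF FE.
  have {}FE (n : nat) : \int[P]_(w in (F n : set Omega)) L w
      = Q ((F n : set Omega) `&` cylinder X J (@pos)) by exact: FE.
  have mF' n : measurable (F n : set Omega) := measurable_obs_event (@mX) (mF n).
  move: (F : (set Omega)^nat) tF mF' FE => {mF}{}F tF mF FE.
  rewrite -[LHS]/(\int[P]_(w in \bigcup_k F k) L w).
  rewrite ge0_integral_bigcup//; last exact/measurable_funTS.
  rewrite setI_bigcupl measure_bigcup//; last 2 first.
  + by move=> n _; exact: measurableI.
  + exact: trivIset_setIr.
  rewrite [RHS](eq_eseriesl (Q := xpredT)); last by move=> n; rewrite in_setT.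
  by apply: eq_eseriesr => n _; exact: FE.
Qed.

End likelihood_ratio.

(** * A Lyapunov function for simultaneous crossings *)

(** The Huber function with transition zone [-H, 0]: it is 0 below -H, quadratic
    on the zone and of slope 1 above 0. Its linear growth makes expected waiting
    times affine in the deficit; its curvature, at most 1/H, makes the second
    order terms small for H large. *)
Definition huber (R : realFieldType) (H z : R) : R :=
  (((Num.max (z + H) 0) ^+ 2 - (Num.max z 0) ^+ 2) / (2 * H))%R.

Definition huber_slope (R : realFieldType) (H z : R) : R :=
  ((Num.max (z + H) 0 - Num.max z 0) / H)%R.

(** Taylor's formula with a second derivative bounded by 1/H. *)
Lemma huber_le_quadratic (R : realFieldType) (H z x : R) : (0 < H)%R ->
  (huber H (z - x) <= huber H z - huber_slope H z * x + x ^+ 2 / (2 * H))%R.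
Proof.
move=> H0; rewrite /huber /huber_slope.
rewrite -subr_ge0.
set a := Num.max (z + H)%R 0%R; set b := Num.max z 0%R.
set c := Num.max (z - x + H)%R 0%R; set e := Num.max (z - x)%R 0%R.
have -> : ((a ^+ 2 - b ^+ 2) / (2 * H) - (a - b) / H * x + x ^+ 2 / (2 * H)
  - (c ^+ 2 - e ^+ 2) / (2 * H) =
    (a ^+ 2 - b ^+ 2 - 2 * (a - b) * x + x ^+ 2 - c ^+ 2 + e ^+ 2) / (2 * H))%R.
  by field; rewrite gt_eqF.
apply: divr_ge0; last lra.
rewrite {}/a {}/b {}/c {}/e.
case: (lerP (z + H)%R 0%R) => h1; case: (lerP z 0%R) => h2;
case: (lerP (z - x + H)%R 0%R) => h3; case: (lerP (z - x)%R 0%R) => h4; nra.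
Qed.

Lemma huber_ge0 (R : realFieldType) (H z : R) : (0 < H)%R -> (0 <= huber H z)%R.
Proof.
move=> H0; rewrite /huber; apply: divr_ge0; last lra.
case: (lerP (z + H)%R 0%R) => h1; case: (lerP z 0%R) => h2; nra.
Qed.

Lemma huber_slope_ge0 (R : realFieldType) (H z : R) : (0 < H)%R -> (0 <= huber_slope H z)%R.
Proof.
move=> H0; rewrite /huber_slope; apply: divr_ge0; last lra.
case: (lerP (z + H)%R 0%R) => h1; case: (lerP z 0%R) => h2; nra.
Qed.

Lemma huber_slope_eq1 (R : realFieldType) (H z : R) : (0 < H)%R -> (0 <= z)%R ->
  huber_slope H z = 1%R.
Proof.
move=> H0 z0; rewrite /huber_slope (max_idPl _)//; last lra.
by rewrite (max_idPl _)// addrAC subrr add0r divff// gt_eqF.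
Qed.

Lemma huber_le_pos (R : realFieldType) (H z : R) : (0 < H)%R ->
  (huber H z <= Num.max (z + H) 0)%R.
Proof.
move=> H0; rewrite /huber ler_pdivrMr; last lra.
case: (lerP (z + H)%R 0%R) => h1; case: (lerP z 0%R) => h2; nra.
Qed.

Lemma huberE_ge0 (R : realFieldType) (H z : R) : (0 < H)%R -> (0 <= z)%R ->
  (huber H z = z + H / 2)%R.
Proof.
move=> H0 z0; rewrite /huber (max_idPl _)//; last lra.
by rewrite (max_idPl _)//; field; rewrite gt_eqF.
Qed.

Lemma measurable_huber d (T : measurableType d) (R : realType) (H : R) (g : T -> R) :
  measurable_fun setT g -> measurable_fun setT (fun x => huber H (g x)).
Proof.
move=> mg; apply: measurable_funM => //; apply: measurable_funB;
  apply: measurable_funX; apply: measurable_maxr => //; exact: measurable_funD.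
Qed.

Lemma excess_le_sq (R : realFieldType) (u c : R) : (0 < c)%R ->
  (Num.max (u - c) 0 <= u ^+ 2 / (4 * c))%R.
Proof.
move=> c0; rewrite ler_pdivlMr; last lra.
case: (lerP (u - c)%R 0%R) => h1; first by rewrite mul0r sqr_ge0.
by have := sqr_ge0 (u - 2 * c)%R; nra.
Qed.

Lemma integral_quadratic d (T : measurableType d) (R : realType)
    (nu : probability T R) (zeta : T -> R) (m E2 al be ga : R) :
  nu.-integrable setT (EFin \o zeta) ->
  \int[nu]_x (zeta x)%:E = m%:E ->
  \int[nu]_x (zeta x ^+ 2)%:E = E2%:E ->
  \int[nu]_x (al + be * zeta x + ga * zeta x ^+ 2)%:E =
    (al + be * m + ga * E2)%:E.
Proof.
move=> iz Ez E2E.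
have mz : measurable_fun setT zeta by exact/measurable_EFinP/(measurable_int nu).
have iz2 : nu.-integrable setT (EFin \o (fun x => zeta x ^+ 2)%R).
  apply/integrableP; split; first exact/measurable_EFinP/measurable_funX.
  by under eq_integral => x _ do rewrite gee0_abs ?lee_fin ?sqr_ge0//; rewrite E2E ltry.
have ial : nu.-integrable setT (fun=> al%:E).
  apply/integrableP; split => //; rewrite integral_cst//= probability_setT mule1.
  by rewrite ltry.
under eq_integral => x _ do rewrite EFinD EFinD !EFinM.
rewrite integralD//; last 2 first.
- by apply: integrableD => //; exact: integrableZl.
- exact: integrableZl.
rewrite integralD//; last exact: integrableZl.
rewrite !integralZl//.
have -> : \int[nu]_x al%:E = al%:E by rewrite integral_cst//= probability_setT mule1.
by rewrite Ez E2E -!EFinM -!EFinD.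
Qed.

Lemma integral_huber_le d (T : measurableType d) (R : realType)
    (nu : probability T R) (zeta : T -> R) (m E2 H z : R) :
  (0 < H)%R -> nu.-integrable setT (EFin \o zeta) ->
  \int[nu]_x (zeta x)%:E = m%:E ->
  \int[nu]_x (zeta x ^+ 2)%:E = E2%:E ->
  \int[nu]_x (huber H (z - zeta x))%:E <=
    (huber H z - huber_slope H z * m + E2 / (2 * H))%:E.
Proof.
move=> H0 iz Ez E2E.
have mz : measurable_fun setT zeta by exact/measurable_EFinP/(measurable_int nu).
rewrite (_ : (huber H z - huber_slope H z * m + E2 / (2 * H) =
  huber H z + - huber_slope H z * m + (2 * H)^-1 * E2)%R); last by ring.
rewrite -(integral_quadratic _ _ _ iz Ez E2E).
apply: ge0_le_integral_nomeas => x _; rewrite lee_fin ?huber_ge0//.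
by rewrite (le_trans (huber_le_quadratic _ _ H0))// mulNr mulrC [(_^-1 * _)%R]mulrC mulrC.
Qed.

Section walks.
Context {R : realType} {K : nat}.
Local Notation I := ('I_K * nat)%type.
Context {d : I -> measure_display}
  {S : forall i, measurableType (d i)} {dO : measure_display}
  {Omega : measurableType dO} (P : probability Omega R)
  (X : forall i : I, Omega -> S i).
Hypothesis mX : forall i, measurable_fun setT (X i).
Hypothesis indepP : forall (J : {fset I}) (B : forall i, set (S i)),
  (forall i, measurable (B i)) ->
  P (cylinder X J B) = \big[mule/1]_(j <- J) P (X j @^-1` B j).
Context (zeta : forall i, S i -> R) (m : I -> R) (E2 : I -> R) (drift sq_bound : R).
Hypothesis iz : forall i, (obs_law P mX i).-integrable setT (EFin \o @zeta i).
Hypothesis mE : forall i, \int[obs_law P mX i]_x (@zeta i x)%:E = (m i)%:E.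
Hypothesis E2E : forall i, \int[obs_law P mX i]_x (@zeta i x ^+ 2)%:E = (E2 i)%:E.
Hypothesis drift0 : (0 < drift)%R.
Hypothesis drift_le : forall i, (drift <= m i)%R.
Hypothesis E2_le : forall i, (E2 i <= sq_bound)%R.

Definition past (t : nat) : {fset I} :=
  [fset x in [seq (k, s) | k <- enum 'I_K, s <- iota 0 t]]%fset.

Lemma in_past t i : (i \in past t) = (i.2 < t)%N.
Proof.
rewrite !inE; apply/allpairsP/idP => [[[k s] /= [_ + ->]]|it].
  by rewrite mem_iota.
by exists i; split; [rewrite mem_enum|rewrite mem_iota|case: i it].
Qed.

Definition walk (n : nat) (k : 'I_K) (w : Omega) : R :=
  (\sum_(0 <= s < n) @zeta (k, s) (X (k, s) w))%R.

Local Notation F n := (obs_field X [set` past n]).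

Lemma past_event_mono n n' (G : set Omega) : (n <= n')%N ->
  (<<s obs_gen X [set` past n] >>) G -> (<<s obs_gen X [set` past n'] >>) G.
Proof.
move=> nn'; apply: smallest_sub; first exact: smallest_sigma_algebra.
move=> _ [i [B [/= iJ mB ->]]]; apply: sub_gen_smallest.
exists i; exists B; split => //=; move: iJ; rewrite !in_past => h.
exact: leq_trans nn'.
Qed.

Lemma measurable_past_mono n n' d' (T : sigmaRingType d') (Y : F n -> T) :
  (n <= n')%N -> measurable_fun setT Y -> measurable_fun setT (Y : F n' -> T).
Proof.
move=> nn' mY _ E mE'; rewrite setTI; apply: (past_event_mono nn').
by rewrite -[Y @^-1` E]setTI; exact: mY.
Qed.

Lemma measurable_walk n k : measurable_fun setT (walk n k : F n -> R).
Proof.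
suff H j : (j <= n)%N -> measurable_fun setT (walk j k : F n -> R) by exact: H.
elim: j => [_|j IH jn].
  rewrite (_ : walk 0 k = cst 0%R); first exact: measurable_cst.
  by apply/funext => w; rewrite /walk big_geq.
rewrite (_ : walk j.+1 k = fun w => (walk j k w + @zeta (k, j) (X (k, j) w))%R).
  apply: measurable_funD; first by apply: IH; exact: ltnW.
  apply: measurableT_comp; first exact/measurable_EFinP/(measurable_int _ (iz _)).
  by apply: measurable_obs_coord; rewrite /= in_past.
by apply/funext => w; rewrite /walk big_nat_recr.
Qed.

Lemma walkS n k w : walk n.+1 k w = (walk n k w + @zeta (k, n) (X (k, n) w))%R.
Proof. by rewrite /walk big_nat_recr. Qed.

Lemma freezing_in n k (U : set Omega) (phi : F n * S (k, n) -> \bar R) :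
  (<<s obs_gen X [set` past n] >>) U ->
  measurable_fun setT phi -> (forall z, 0 <= phi z) ->
  \int[P]_(w in U) phi (w, X (k, n) w) =
  \int[P]_(w in U) \int[obs_law P mX (k, n)]_x phi (w, x).
Proof.
move=> mU mphi phi0; rewrite integral_mkcond [RHS]integral_mkcond.
pose phi' (z : F n * S (k, n)) := (\1_(U : set (F n)) z.1)%:E * phi z.
transitivity (\int[P]_w phi' (w, X (k, n) w)).
  by apply: eq_integral => w _; rewrite patchE /phi' indicE /=;
     case: (w \in U); rewrite ?mul1e ?mul0e.
rewrite (freezing mX indepP (phi := phi')); last 3 first.
- by rewrite in_past/= ltnn.
- apply: emeasurable_funM => //; apply/measurable_EFinP.
  by apply: measurableT_comp => //; exact: measurable_indic.
- by move=> z; rewrite mule_ge0// lee_fin.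
apply: eq_integral => w _; rewrite patchE /phi' /= indicE.
case: (w \in U); first by under eq_integral do rewrite mul1e.
by under eq_integral do rewrite mul0e; rewrite integral0.
Qed.

(** Each step adds its own variance, which is at most its second moment. *)
Lemma walk_variance_le n :
  forall k, \int[P]_w ((\sum_(0 <= s < n) m (k, s) - walk n k w) ^+ 2)%:E
    <= (n%:R * sq_bound)%:E.
Proof.
move=> k; elim: n => [|n IH].
  under eq_integral do rewrite /walk !big_geq// subrr expr0n.
  by rewrite integral0 mul0r.
set N := fun w => (\sum_(0 <= s < n) m (k, s) - walk n k w)%R in IH *.
have mN : measurable_fun setT (N : F n -> R).
  by apply: measurable_funB => //; exact: measurable_walk.
pose phi (z : F n * S (k, n)) := ((N z.1 + (m (k, n) - @zeta _ z.2)) ^+ 2)%:E.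
have mphi : measurable_fun setT phi.
  apply/measurable_EFinP; apply: measurable_funX; apply: measurable_funD.
    exact: measurableT_comp.
  apply: measurable_funB => //; apply: measurableT_comp => //.
  exact/measurable_EFinP/(measurable_int _ (iz _)).
have phi0 z : 0 <= phi z by rewrite lee_fin sqr_ge0.
have mN2 : measurable_fun setT (fun w => (N w ^+ 2)%:E : \bar R).
  apply/measurable_EFinP; apply: measurable_funX.
  exact: (measurable_obs_field mX mN).
have -> : \int[P]_w ((\sum_(0 <= s < n.+1) m (k, s) - walk n.+1 k w) ^+ 2)%:E
    = \int[P]_w phi (w, X (k, n) w).
  apply: eq_integral => w _; rewrite /phi /N/= walkS big_nat_recr//=.
  by congr (_ ^+ 2)%:E; ring.
rewrite (freezing mX indepP); [|by rewrite in_past/= ltnn|exact: mphi|exact: phi0].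
apply: (@le_trans _ _ (\int[P]_w ((N w ^+ 2)%:E + sq_bound%:E))).
  apply: ge0_le_integral_nomeas => w _.
    by apply: integral_ge0 => x _; exact: phi0.
  rewrite /phi /=.
  under eq_integral => x _.
    rewrite (_ : ((N w + (m (k, n) - @zeta _ x)) ^+ 2 = (N w + m (k, n)) ^+ 2
      + (- 2 * (N w + m (k, n))) * @zeta _ x + 1 * @zeta _ x ^+ 2)%R); last by ring.
    over.
  rewrite (integral_quadratic _ _ _ (iz _) (mE _) (E2E _)) -EFinD lee_fin.
  by have := E2_le (k, n); have := sqr_ge0 (m (k, n)); nra.
have M20 : (0 <= sq_bound)%R.
  apply: le_trans (E2_le (k, n)); rewrite -lee_fin -E2E.
  by apply: integral_ge0 => x _; rewrite lee_fin sqr_ge0.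
rewrite ge0_integralD//; last by move=> w _; rewrite lee_fin sqr_ge0.
rewrite integral_cst//= probability_setT mule1 -natr1 mulrDl mul1r EFinD.
exact: leeD2r.
Qed.

Section potential.
Variables (H : R) (t : nat) (Y : 'I_K -> Omega -> R) (U : nat -> set Omega).
Hypothesis H0 : (0 < H)%R.
Hypothesis HM : (K%:R * sq_bound <= drift * H)%R.
Hypothesis mY : forall k, measurable_fun setT (Y k : F t -> R).
Hypothesis mU : forall n, (t <= n)%N -> (<<s obs_gen X [set` past n] >>) (U n).
Hypothesis Udec : forall n, (t <= n)%N -> U n.+1 `<=` U n.
Hypothesis UY : forall n w, (t <= n)%N -> U n w ->
  exists k, (walk n k w <= Y k w)%R.

Let V n w := (\sum_(k < K) huber H (Y k w - walk n k w))%R.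

(** On U n some deficit Y k - walk n k is nonnegative, so its Huber function has
    slope 1 and the next step decreases it by at least drift on average. The
    second order terms of the K walks amount to K * sq_bound / (2 * H) in total,
    which [HM] makes at most half of this gain. *)
Lemma huber_drift n : (t <= n)%N ->
  \int[P]_(w in U n.+1) (V n.+1 w)%:E + (drift / 2)%:E * P (U n) <=
  \int[P]_(w in U n) (V n w)%:E.
Proof.
move=> tn.
have mYw k : measurable_fun setT ((fun w => Y k w - walk n k w)%R : F n -> R).
  apply: measurable_funB; first exact: (measurable_past_mono tn (mY k)).
  exact: measurable_walk.
have mUn := measurable_obs_event mX (mU tn).
have mUn1 := measurable_obs_event mX (mU (leqW tn)).
have V0 j w : (0 <= V j w)%R by apply: sumr_ge0 => k _; exact: huber_ge0.
pose phi k (z : F n * S (k, n)) : \bar R :=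
  (huber H (Y k z.1 - walk n k z.1 - @zeta _ z.2))%:E.
have mphi k : measurable_fun setT (@phi k).
  apply/measurable_EFinP; apply: measurable_huber; apply: measurable_funB.
    exact: (measurableT_comp (mYw k)).
  apply: measurableT_comp => //.
  exact/measurable_EFinP/(measurable_int _ (iz _)).
have phi0 k z : 0 <= @phi k z by rewrite lee_fin huber_ge0.
pose inner k w := \int[obs_law P mX (k, n)]_x @phi k (w, x).
have inner0 k w : 0 <= inner k w by apply: integral_ge0.
have minner k : measurable_fun setT (inner k : Omega -> \bar R).
  by apply: (measurable_obs_field mX (J := [set` past n])); exact: measurable_fun_fubini_tonelli_F.
have mpV j k : measurable_fun setT (fun w => (huber H (Y k w - walk j k w))%:E : \bar R).
  apply/measurable_EFinP; apply: measurable_huber; apply: measurable_funB.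
    exact: (measurable_obs_field mX (mY k)).
  by apply: (measurable_obs_field mX (J := [set` past j])); exact: measurable_walk.
have mV j : measurable_fun setT (fun w => (V j w)%:E).
  under eq_fun do rewrite /V -sumEFin.
  exact: emeasurable_sum.
apply: (@le_trans _ _ (\int[P]_(w in U n) (V n.+1 w)%:E + (drift / 2)%:E * P (U n))).
  rewrite leeD2r//; apply: ge0_subset_integral => //; last exact: Udec.
    exact: measurable_funTS.
  by move=> w _; rewrite lee_fin.
have -> : \int[P]_(w in U n) (V n.+1 w)%:E = \int[P]_(w in U n) (\sum_(k < K) inner k w).
  under eq_integral do rewrite /V -sumEFin.
  rewrite ge0_integral_sum//; last 2 first.
  - by move=> k; exact: measurable_funTS.
  - by move=> k w _; rewrite lee_fin huber_ge0.
  rewrite ge0_integral_sum//; last by move=> k; exact: measurable_funTS.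
  apply: eq_bigr => k _; rewrite -(@freezing_in n k (U n) (@phi k))//; last exact: mU.
  by apply: eq_integral => w _; rewrite /phi/= walkS opprD addrA.
rewrite -integral_cst// -ge0_integralD//; last 3 first.
- by move=> w _; exact: sume_ge0.
- by apply: measurable_funTS; exact: emeasurable_sum.
- by move=> w _; rewrite /= lee_fin divr_ge0// ltW.
apply: ge0_le_integral_nomeas => w Uw /=.
  by rewrite adde_ge0 ?sume_ge0// lee_fin divr_ge0// ltW.
have [k0 k0Y] := UY tn Uw.
pose Z k := (Y k w - walk n k w)%R.
apply: (@le_trans _ _ (\sum_(k < K) (huber H (Z k) - huber_slope H (Z k) * drift +
    sq_bound / (2 * H))%:E + (drift / 2)%:E)).
  rewrite leeD2r//; apply: lee_sum => k _.
  apply: le_trans (integral_huber_le (Z k) H0 (iz _) (mE _) (E2E _)) _.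
  rewrite lee_fin lerD//; last by rewrite ler_pM2r// invr_gt0 mulr_gt0.
  by rewrite lerB// ler_wpM2l// huber_slope_ge0.
rewrite sumEFin -EFinD lee_fin /V !big_split/= sumrN.
rewrite sumr_const card_ord.
have s1 : (1 <= \sum_(k < K) huber_slope H (Z k))%R.
  rewrite (bigD1 k0)//= huber_slope_eq1//; last by rewrite /Z subr_ge0.
  by rewrite lerDl; apply: sumr_ge0 => k _; exact: huber_slope_ge0.
have s2 : (sq_bound / (2 * H) *+ K <= drift / 2)%R.
  rewrite -mulr_natl mulrA ler_pdivrMr ?mulr_gt0//.
  by rewrite mulrA divfK.
rewrite /Z in s1 *; rewrite -!addrA gerDl addrC subr_le0.
apply: (le_trans (lerD s2 (lexx _))); rewrite -splitr.
by rewrite -mulr_suml ler_peMl// ltW.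
Qed.

Lemma huber_drift_sum N :
  (drift / 2)%:E * \sum_(t <= n < t + N) P (U n) <= \int[P]_(w in U t) (V t w)%:E.
Proof.
suff h : (drift / 2)%:E * \sum_(t <= n < t + N) P (U n) +
    \int[P]_(w in U (t + N)%N) (V (t + N)%N w)%:E <= \int[P]_(w in U t) (V t w)%:E.
  apply: le_trans h; rewrite leeDl//; apply: integral_ge0 => w _.
  by rewrite lee_fin; apply: sumr_ge0 => k _; exact: huber_ge0.
elim: N => [|N IH]; first by rewrite addn0 big_geq// mule0 add0e.
apply: le_trans IH; rewrite addnS big_nat_recr ?leq_addr//=.
rewrite ge0_muleDr//; last exact: sume_ge0.
rewrite -addeA leeD2l// addeC; exact: huber_drift (leq_addr _ _).
Qed.

End potential.

(** A walk at time n0 is below y + H only if it deviates from its mean by at least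
    c = drift * n0 / 2. Bounding the excess u - c of the deviation u by u^2 / (4 c)
    compensates the variance, which is at most n0 * sq_bound, by the factor 1 / n0
    of 1 / c, so the bound does not depend on n0. *)
Lemma huber_tail_le (H y : R) (n0 : nat) : (0 < H)%R -> (0 < n0)%N ->
  (2 * (y + H) <= drift * n0%:R)%R ->
  \int[P]_w (\sum_(k < K) huber H (y - walk n0 k w))%:E <= (K%:R * (sq_bound / (2 * drift)))%:E.
Proof.
move=> H0 n00 yn0.
have n0R : (0 < n0%:R :> R)%R by rewrite ltr0n.
have c0 : (0 < drift * n0%:R / 2)%R by rewrite divr_gt0// mulr_gt0.
have mw k : measurable_fun setT (walk n0 k).
  by apply: (measurable_obs_field mX (J := [set` past n0])); exact: measurable_walk.
under eq_integral do rewrite -sumEFin.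
rewrite ge0_integral_sum//; last 2 first.
- move=> k; apply/measurable_EFinP; apply: measurable_huber.
  by apply: measurable_funB.
- by move=> k w _; rewrite lee_fin huber_ge0.
apply: (@le_trans _ _ (\sum_(k < K) (sq_bound / (2 * drift))%:E)); last first.
  by rewrite sumEFin lee_fin sumr_const card_ord -[leLHS]mulr_natl.
apply: lee_sum => k _.
pose N w := (\sum_(0 <= s < n0) m (k, s) - walk n0 k w)%R.
apply: (@le_trans _ _ (\int[P]_w ((4 * (drift * n0%:R / 2))^-1%:E * (N w ^+ 2)%:E))).
  apply: ge0_le_integral_nomeas => w _; first by rewrite lee_fin huber_ge0.
  rewrite -EFinM lee_fin; apply: le_trans (huber_le_pos _ H0) _.
  rewrite [leRHS]mulrC; apply: le_trans (excess_le_sq (N w) c0).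
  rewrite ge_max !le_max lexx orbT andbT; apply/orP; left.
  have : (drift * n0%:R <= \sum_(0 <= s < n0) m (k, s))%R.
    rewrite -[in leLHS](subn0 n0) mulr_natr -sumr_const_nat.
    by apply: ler_sum => s _; exact: drift_le.
  rewrite /N; lra.
rewrite ge0_integralZl//; last 3 first.
- by apply/measurable_EFinP; apply: measurable_funX; exact: measurable_funB.
- by move=> w _; rewrite lee_fin sqr_ge0.
- by rewrite lee_fin invr_ge0 ltW// mulr_gt0.
apply: le_trans (lee_wpmul2l _ (walk_variance_le n0 k)) _.
  by rewrite lee_fin invr_ge0 ltW// mulr_gt0.
rewrite -EFinM lee_fin le_eqVlt; apply/orP; left; apply/eqP.
by field; rewrite !gt_eqF.
Qed.

Definition unpassed (G : set Omega) (Y : 'I_K -> Omega -> R) (t n : nat) : set Omega :=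
  [set w | G w /\ forall j, (t <= j <= n)%N -> exists k, (walk j k w < Y k w)%R].

Lemma measurable_unpassed (G : set Omega) (Y : 'I_K -> Omega -> R) (t n : nat) :
  (t <= n)%N -> (<<s obs_gen X [set` past t] >>) G ->
  (forall k, measurable_fun setT (Y k : F t -> R)) ->
  (<<s obs_gen X [set` past n] >>) (unpassed G Y t n).
Proof.
move=> tn mG mY.
have -> : unpassed G Y t n = G `&` \bigcap_(j in [set j | (t <= j <= n)%N])
    \bigcup_(k : 'I_K) [set w | (walk j k w < Y k w)%R].
  apply/seteqP; split => [w [Gw h]|w [Gw h]]; split => // j /h [k]; first by exists k.
  by exists k.
apply: (@measurableI _ (F n)).
  exact: past_event_mono mG.
apply: (@bigcap_measurableType _ (F n)) => j /andP[tj jn].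
apply: (@fin_bigcup_measurable _ (F n)) => // k _.
rewrite -[X in measurable X]setTI.
apply: (@measurable_lte _ (F n) R setT _ (fun w => (walk j k w)%:E) (fun w => (Y k w)%:E)).
- exact: (@measurableT _ (F n)).
- apply/measurable_EFinP; apply: (measurable_past_mono jn); exact: measurable_walk.
- apply/measurable_EFinP; exact: (measurable_past_mono tn (mY k)).
Qed.

(** The series is the expected time, counted from t and on the event G, until the
    K walks are simultaneously above the levels Y. *)
Lemma unpassed_sum (H : R) (G : set Omega) (Y : 'I_K -> Omega -> R) (t : nat) :
  (0 < H)%R -> (K%:R * sq_bound <= drift * H)%R -> (<<s obs_gen X [set` past t] >>) G ->
  (forall k, measurable_fun setT (Y k : F t -> R)) ->
  (drift / 2)%:E * \sum_(n <oo) P (unpassed G Y t (t + n)) <=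
  \int[P]_(w in G) (\sum_(k < K) huber H (Y k w - walk t k w))%:E.
Proof.
move=> H0 HM mG mY.
have mU n : (t <= n)%N -> (<<s obs_gen X [set` past n] >>) (unpassed G Y t n).
  by move=> tn; exact: measurable_unpassed.
have Udec n : (t <= n)%N -> unpassed G Y t n.+1 `<=` unpassed G Y t n.
  move=> _ w [Gw h]; split=> // j /andP[tj jn]; apply: h.
  by rewrite tj leqW.
have UY n w : (t <= n)%N -> unpassed G Y t n w -> exists k, (walk n k w <= Y k w)%R.
  by move=> tn [_ /(_ n)]; rewrite tn leqnn => /(_ isT)[k /ltW]; exists k.
apply: (@le_trans _ _ (\int[P]_(w in unpassed G Y t t)
    (\sum_(k < K) huber H (Y k w - walk t k w))%:E)); last first.
  apply: ge0_subset_integral.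
  - exact: (measurable_obs_event mX (mU t (leqnn t))).
  - exact: (measurable_obs_event mX mG).
  - apply: measurable_funTS; apply/measurable_EFinP; apply: measurable_sum => k.
    apply: measurable_huber; apply: measurable_funB; first exact: (measurable_obs_field mX (mY k)).
    by apply: (measurable_obs_field mX (J := [set` past t])); exact: measurable_walk.
  - by move=> w _; rewrite lee_fin sumr_ge0// => k _; exact: huber_ge0.
  - by move=> w [].
rewrite -nneseriesZl ?divr_ge0 ?(ltW drift0)//.
apply: lime_le.
  by apply: is_cvg_nneseries => n _ _; rewrite mule_ge0// lee_fin divr_ge0// ltW.
apply: nearW => N.
have := huber_drift_sum H0 HM mY mU Udec UY N; apply: le_trans.
rewrite -ge0_sume_distrr; last by move=> n _; exact: measure_ge0.
rewrite lee_wpmul2l ?lee_fin ?divr_ge0 ?(ltW drift0)//.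
have := big_addn 0 (t + N) t xpredT (fun n => P (unpassed G Y t n)) => /(_ (0 : \bar R) +%E).
rewrite add0n [X in (X - t)%N]addnC addnK => ->.
by rewrite le_eqVlt; apply/orP; left; apply/eqP; apply: eq_bigr => n _; rewrite addnC.
Qed.

End walks.

(** * One stream *)

(** A finite version of the log-likelihood ratio of g1 to g0. The conventional
    value 0 is taken with probability zero under g1, by [both_pos_ae]. *)
Definition real_llr (R : realType) (T : Type) (g1 g0 : T -> R) (x : T) : R :=
  (if (0 < g1 x) && (0 < g0 x) then ln (g1 x) - ln (g0 x) else 0)%R.

Definition both_pos (R : realType) (T : Type) (g1 g0 : T -> R) : set T :=
  [set x | (0 < g1 x)%R /\ (0 < g0 x)%R].

Section one_stream.
Context d (T : measurableType d) (R : realType)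
  (mu : {sigma_finite_measure set T -> \bar R}) (nu : probability T R)
  (g1 g0 : T -> R).
Hypothesis d1 : is_density mu g1.
Hypothesis d0 : is_density mu g0.
Hypothesis nuE : forall B, measurable B -> nu B = \int[mu]_(x in B) (g1 x)%:E.
Hypothesis KL : 0 < \int[mu]_x (llr g1 g0 x * (g1 x)%:E).
Hypothesis var : \int[mu]_x (llr g1 g0 x ^+ 2 * (g1 x)%:E) < +oo.

Let m1 : measurable_fun setT g1. Proof. by case: d1. Qed.
Let m0 : measurable_fun setT g0. Proof. by case: d0. Qed.
Let g1_ge0 x : (0 <= g1 x)%R. Proof. by case: d1. Qed.
Let g0_ge0 x : (0 <= g0 x)%R. Proof. by case: d0. Qed.

Let mpos1 (g : T -> R) : measurable_fun setT g -> measurable [set x | (0 < g x)%R].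
Proof.
move=> mg; rewrite (_ : [set x | _] = setT `&` g @^-1` `]0%R, +oo[%classic); last first.
  by rewrite setTI; apply/seteqP; split=> x /=; rewrite in_itv/= andbT.
exact: mg.
Qed.

Lemma measurable_both_pos : measurable (both_pos g1 g0).
Proof.
rewrite (_ : both_pos g1 g0 = [set x | (0 < g1 x)%R] `&` [set x | (0 < g0 x)%R])//.
by apply: measurableI; exact: mpos1.
Qed.

Lemma real_llrE x : both_pos g1 g0 x -> real_llr g1 g0 x = (ln (g1 x) - ln (g0 x))%R.
Proof. by move=> [h1 h0]; rewrite /real_llr h1 h0. Qed.

Lemma real_llr0 x : ~ both_pos g1 g0 x -> real_llr g1 g0 x = 0%R.
Proof.
rewrite /real_llr; case: (ltrP 0%R (g1 x)) => //= h1; case: (ltrP 0%R (g0 x)) => //= h0.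
by case; split.
Qed.

Lemma llr_finite x : both_pos g1 g0 x -> llr g1 g0 x = (real_llr g1 g0 x)%:E.
Proof.
move=> h; have [h1 h0] := h; rewrite real_llrE// /llr inver gt_eqF//.
by rewrite -EFinM lne_EFin ?divr_gt0// ln_div.
Qed.

Lemma measurable_real_llr : measurable_fun setT (real_llr g1 g0).
Proof.
rewrite (_ : real_llr g1 g0 = fun x => ((ln (g1 x) - ln (g0 x)) * \1_(both_pos g1 g0) x)%R).
  apply: measurable_funM; last exact: measurable_indic measurable_both_pos.
  by apply: measurable_funB; apply: measurableT_comp => //; exact: measurable_ln.
apply/funext => x; rewrite indicE.
have [xp|xp] := pselect (both_pos g1 g0 x).
  by rewrite mem_set// mulr1 real_llrE.
by rewrite memNset// mulr0 real_llr0.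
Qed.

Let N := [set x | (0 < g1 x)%R] `\` [set x | (0 < g0 x)%R].
Let mN : measurable N. Proof. by apply: measurableD; exact: mpos1. Qed.

Let llrN x : N x -> llr g1 g0 x = +oo.
Proof.
move=> [h1 /negP]; rewrite -leNgt => h0.
have g00 : g0 x = 0%R by apply/eqP; rewrite eq_le h0 g0_ge0.
by rewrite /llr inver g00 eqxx gt0_muley ?lte_fin.
Qed.

Let ge0_sq x : 0 <= llr g1 g0 x ^+ 2 * (g1 x)%:E.
Proof. by rewrite mule_ge0 ?lee_fin// sqre_ge0. Qed.

Let muN : mu N = 0.
Proof.
apply/eqP; rewrite eq_le measure_ge0 andbT leNgt; apply/negP => N0.
move: var; rewrite ltNge => /negP; apply.
apply: (@le_trans _ _ (\int[mu]_(x in N) (llr g1 g0 x ^+ 2 * (g1 x)%:E))).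
  rewrite (eq_integral (cst +oo)).
    by rewrite integral_cst// gt0_mulye.
  move=> x /[!inE] Nx; rewrite llrN// expe2 mulyy gt0_mulye//.
  by rewrite lte_fin; case: Nx.
rewrite integral_mkcond; apply: ge0_le_integral_nomeas => x _; rewrite patchE.
  by case: ifP.
by case: ifP.
Qed.

Let mN1 : measurable (~` [set x | (0 < g1 x)%R]).
Proof. by apply: measurableC; exact: mpos1. Qed.

Let g1_0 x : ~ (0 < g1 x)%R -> g1 x = 0%R.
Proof. by move=> /negP; rewrite -leNgt => h; apply/eqP; rewrite eq_le h g1_ge0. Qed.

Let npos_cases x : ~ both_pos g1 g0 x -> N x \/ g1 x = 0%R.
Proof.
move=> h; have [h1|/g1_0] := pselect (0 < g1 x)%R; last by right.
by left; split => // h0; apply: h.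
Qed.

(** Where g1 > 0 = g0 the log-likelihood ratio is +oo, so a finite second moment
    under g1 forces this set to be negligible. *)
Lemma both_pos_ae : nu (~` both_pos g1 g0) = 0.
Proof.
have nuN : nu N = 0.
  by rewrite nuE// null_set_integral//; apply/measurable_EFinP; exact: measurable_funTS.
have nuN1 : nu (~` [set x | (0 < g1 x)%R]) = 0.
  rewrite nuE// integral0_eq// => x h; by rewrite g1_0.
apply/eqP; rewrite eq_le measure_ge0 andbT.
apply: (@le_trans _ _ (nu (~` [set x | (0 < g1 x)%R] `|` N))).
  apply: le_measure; rewrite ?inE.
  - by apply: measurableC; exact: measurable_both_pos.
  - exact: measurableU.
  - by move=> x /npos_cases[Nx|g10]; [right|left => /=; rewrite g10 ltxx].
apply: (le_trans (measureU2 _ _ _)) => //; apply: adde_le0.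
  by rewrite le_eqVlt; apply/orP; left; apply/eqP; exact: nuN1.
by rewrite le_eqVlt; apply/orP; left; apply/eqP; exact: nuN.
Qed.

Lemma real_llr_sq_lty : \int[nu]_x (real_llr g1 g0 x ^+ 2)%:E < +oo.
Proof.
rewrite (integral_density m1 g1_ge0 nuE); last 2 first.
- apply/measurable_EFinP; apply: measurable_funX; exact: measurable_real_llr.
- by move=> x; rewrite lee_fin sqr_ge0.
apply: le_lt_trans var; apply: ge0_le_integral_nomeas => x _.
  by rewrite mule_ge0// lee_fin ?sqr_ge0.
have [xp|xp] := pselect (both_pos g1 g0 x).
  by rewrite llr_finite// EFin_expe.
by rewrite real_llr0// expr0n mul0e.
Qed.

Lemma integrable_real_llr : nu.-integrable setT (EFin \o real_llr g1 g0).
Proof.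
apply/integrableP; split; first exact/measurable_EFinP/measurable_real_llr.
apply: (@le_lt_trans _ _ (\int[nu]_x (1 + (real_llr g1 g0 x ^+ 2)%:E))).
  apply: ge0_le_integral_nomeas => x _; first exact: abse_ge0.
  rewrite -EFinD lee_fin /=.
  have := sqr_ge0 (`|real_llr g1 g0 x| - 1)%R; rewrite sqrrB real_normK ?num_real//; nra.
rewrite ge0_integralD//; last 2 first.
- by move=> x _; rewrite lee_fin sqr_ge0.
- apply/measurable_EFinP; apply: measurable_funX; exact: measurable_real_llr.
by rewrite integral_cst//= probability_setT mule1 lte_add_pinfty// ?ltry// real_llr_sq_lty.
Qed.

Let llrM x : ~ N x -> llr g1 g0 x * (g1 x)%:E = (real_llr g1 g0 x * g1 x)%:E.
Proof.
move=> Nx; have [xp|/npos_cases[//|g10]] := pselect (both_pos g1 g0 x).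
  by rewrite llr_finite// EFinM.
by rewrite g10 mule0 mulr0.
Qed.

Let mztg : measurable_fun setT (fun x => (real_llr g1 g0 x * g1 x)%:E).
Proof.
by apply/measurable_EFinP; apply: measurable_funM => //; exact: measurable_real_llr.
Qed.

Let mllrM : measurable_fun setT (fun x => llr g1 g0 x * (g1 x)%:E).
Proof.
rewrite (_ : (fun x => _) = fun x => (real_llr g1 g0 x * g1 x)%:E + +oo * (\1_N x)%:E).
  apply: emeasurable_funD => //; apply: emeasurable_funM => //.
  by apply/measurable_EFinP; exact: measurable_indic.
apply/funext => x; rewrite indicE; have [Nx|Nx] := pselect (N x); last first.
  by rewrite memNset// mule0 adde0 llrM.
rewrite mem_set// mule1 addey// llrN// gt0_mulye// lte_fin; by case: Nx.
Qed.

(** The mean is the Kullback-Leibler divergence of the assumption [KL], because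
    the two integrands only differ on the negligible set N. *)
Lemma real_llr_mean_gt0 : 0 < \int[nu]_x (real_llr g1 g0 x)%:E.
Proof.
suff -> : \int[nu]_x (real_llr g1 g0 x)%:E = \int[mu]_x (llr g1 g0 x * (g1 x)%:E) by [].
transitivity (\int[mu]_x (real_llr g1 g0 x * g1 x)%:E); last first.
  apply: ae_eq_integral => //; exists N; split => // x /=.
  by apply: contra_notP => Nx _; rewrite llrM.
have mz := measurable_real_llr.
rewrite integralE [RHS]integralE; congr (_ - _).
- rewrite (integral_density m1 g1_ge0 nuE)//; last exact/measurable_funepos/measurable_EFinP.
  apply: eq_integral => x _; rewrite !funeposE.
  by rewrite -!EFin_max -EFinM maxr_pMl ?mul0r.
- rewrite (integral_density m1 g1_ge0 nuE)//; last exact/measurable_funeneg/measurable_EFinP.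
  apply: eq_integral => x _; rewrite !funenegE.
  by rewrite -!EFinN -!EFin_max -EFinM maxr_pMl ?mul0r// mulNr.
Qed.

Lemma real_llr_likelihood (C : set T) : measurable C ->
  \int[nu]_(x in C) (expR (- real_llr g1 g0 x))%:E =
  \int[mu]_(x in C `&` both_pos g1 g0) (g0 x)%:E.
Proof.
move=> mC; have mP := measurable_both_pos.
have me : measurable_fun setT (fun x => (expR (- real_llr g1 g0 x))%:E).
  apply/measurable_EFinP; apply: measurableT_comp => //.
  by apply: measurableT_comp => //; exact: measurable_real_llr.
rewrite [LHS]integral_mkcond (integral_density m1 g1_ge0 nuE); last 2 first.
- by apply/(measurable_restrictT _ _).1 => //; exact: measurable_funTS.
- by apply: erestrict_ge0 => x _; rewrite lee_fin expR_ge0.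
transitivity (\int[mu]_(x in C) ((expR (- real_llr g1 g0 x))%:E * (g1 x)%:E)).
  rewrite [RHS]integral_mkcond; apply: eq_integral => x _; rewrite !patchE.
  by case: ifP => //; rewrite mul0e.
have CE : C = (C `&` both_pos g1 g0) `|` (C `\` both_pos g1 g0).
  by rewrite setDE -setIUr setUv setIT.
rewrite {1}CE ge0_integral_setU//; last 5 first.
- exact: measurableI.
- exact: measurableD.
- apply: measurable_funTS; apply: emeasurable_funM => //; exact/measurable_EFinP.
- by move=> x _; rewrite mule_ge0// lee_fin ?expR_ge0.
- by apply/disj_setPS => x [[_ ?] [_ ?]].
rewrite [X in _ + X](_ : _ = 0) ?adde0.
  apply: eq_integral => x /[!inE] -[_ xp]; rewrite real_llrE// opprB -EFinM expRD expRN.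
  by case: xp => h1 h0; rewrite !lnK ?posrE// divfK// gt_eqF.
transitivity (nu (C `\` both_pos g1 g0)).
  rewrite nuE//; last exact: measurableD.
  apply: eq_integral => x /[!inE] -[_ xp]; rewrite real_llr0// oppr0 expR0 mul1e//.
apply/eqP; rewrite eq_le measure_ge0 andbT -both_pos_ae; apply: le_measure; rewrite ?inE.
- exact: measurableD.
- exact: measurableC.
- by move=> x [].
Qed.

End one_stream.

(** * The observed streams *)

(** A time is s plus the number of later instants that precede it, and the terms
    of the series majorize the indicators of these instants. *)
Lemma time_ereal_le (R : realType) (o : option nat) (s : nat) (a : nat -> \bar R) :
  (forall n, 0 <= a n) -> (forall n, ~~ time_le o (s + n) -> 1 <= a n) ->
  time_ereal R o <= s%:R%:E + \sum_(n <oo) a n.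
Proof.
move=> a0 a1.
have part k : (forall n, (n < k)%N -> ~~ time_le o (s + n)) ->
    k%:R%:E <= \sum_(n <oo) a n.
  move=> h; apply: (@le_trans _ _ (\sum_(0 <= n < k) a n)).
    rewrite (_ : k%:R%:E = \sum_(0 <= n < k) (1%E : \bar R)).
      by rewrite !big_nat; apply: lee_sum => n /andP[_ nk]; apply: a1; exact: h.
    by rewrite sumEFin sumr_const_nat subn0.
  exact: nneseries_lim_ge.
case: o a1 part => [u|] /= a1 part.
  have [us|su] := leqP u s.
    rewrite -[leLHS]adde0; apply: leeD; first by rewrite lee_fin ler_nat.
    exact: nneseries_ge0.
  rewrite -(subnKC (ltnW su)) natrD EFinD leeD2l// part// => n nu.
  by rewrite -ltnNge -ltn_subRL.
rewrite (_ : \sum_(n <oo) a n = +oo) ?addey//.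
apply/eqyP => r r0; apply: le_trans (part (Num.truncn r).+1 _) => //.
by rewrite lee_fin ltW// truncnS_gt.
Qed.

Definition symd (T : finType) (A B : {set T}) : {set T} :=
  ((A :\: B) :|: (B :\: A))%SET.

Section model.
Context {R : realType} {K : nat} {d : 'I_K -> measure_display}
  {S : forall k, measurableType (d k)}
  (mu : forall k, {sigma_finite_measure set (S k) -> \bar R})
  (f : forall k, bool -> S k -> R)
  (hf : forall k i, is_density (mu k) (f k i))
  {dO : measure_display} {Omega : measurableType dO}
  (P : {set 'I_K} -> probability Omega R)
  (X : forall k, nat -> Omega -> S k)
  (hX : iid_streams mu f P X)
  (hKL : forall k i,
     0 < \int[mu k]_x (llr (f k i) (f k (~~ i)) x * (f k i x)%:E))
  (hvar : forall k i,
     \int[mu k]_x (llr (f k i) (f k (~~ i)) x ^+ 2 * (f k i x)%:E) < +oo)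
  (A : {set 'I_K}).

Local Notation I := ('I_K * nat)%type.

Definition obs (j : I) : Omega -> S j.1 := X j.1 j.2.
(** The sign is chosen so that the walks drift upwards under P A. *)
Definition zeta (j : I) : S j.1 -> R :=
  real_llr (@f j.1 (j.1 \in A)) (@f j.1 (~~ (j.1 \in A))).
Definition regular (k : 'I_K) : set (S k) :=
  both_pos (@f k (k \in A)) (@f k (~~ (k \in A))).

Lemma measurable_obs j : measurable_fun setT (obs j).
Proof. by case: hX => h _ _; exact: h. Qed.

Lemma indep_obs B' (J : {fset I}) (B : forall j : I, set (S j.1)) :
  (forall j, measurable (B j)) ->
  P B' (cylinder obs J B) = \big[mule/1]_(j <- J) P B' (obs j @^-1` B j).
Proof.
move=> mB; case: hX => _ _ /(_ B' J (fun k s => B (k, s)) (fun k s => mB (k, s))) h.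
rewrite (_ : cylinder obs J B = \bigcap_(j in [set` J]) (X j.1 j.2 @^-1` B (j.1, j.2))).
  by rewrite h; apply: eq_bigr => -[].
by apply: eq_bigcapr => -[].
Qed.

Lemma marginal_density B' (j : I) B : measurable B ->
  P B' (obs j @^-1` B) = \int[mu j.1]_(x in B) (@f j.1 (j.1 \in B') x)%:E.
Proof. by move=> mB; case: hX => _ h _; exact: h. Qed.

Definition lawA (j : I) : probability (S j.1) R := obs_law (P A) measurable_obs j.

Lemma lawAE j B : measurable B ->
  lawA j B = \int[mu j.1]_(x in B) (@f j.1 (j.1 \in A) x)%:E.
Proof. exact: marginal_density. Qed.

(** The moments are taken at time 0: all the observations of a stream have the
    same law, and there are only finitely many streams to bound them over. *)
Definition mean (j : I) : R := fine (\int[lawA (j.1, 0%N)]_x (zeta (j := j) x)%:E).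
Definition second_moment (j : I) : R :=
  fine (\int[lawA (j.1, 0%N)]_x (zeta (j := j) x ^+ 2)%:E).

Lemma integrable_zeta j : (lawA j).-integrable setT (EFin \o zeta (j := j)).
Proof.
apply: (integrable_real_llr (hf j.1 (j.1 \in A)) (hf j.1 (~~ (j.1 \in A)))).
- exact: lawAE.
- exact: hvar.
Qed.

Lemma law_same j (B : set (S j.1)) : measurable B ->
  lawA j B = lawA (j.1, 0%N) B.
Proof. by move=> mB; rewrite lawAE// [RHS](@lawAE (j.1, 0%N)). Qed.

Lemma mean_zeta j : \int[lawA j]_x (zeta (j := j) x)%:E = (mean j)%:E.
Proof.
rewrite /mean fineK; last exact: (integrable_fin_num measurableT (integrable_zeta (j.1, 0%N))).
by apply: eq_measure_integral => B mB _; exact: law_same.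
Qed.

Lemma second_moment_zeta j : \int[lawA j]_x (zeta (j := j) x ^+ 2)%:E = (second_moment j)%:E.
Proof.
rewrite /second_moment fineK.
  by apply: eq_measure_integral => B mB _; exact: law_same.
rewrite ge0_fin_numE; last by apply: integral_ge0 => x _; rewrite lee_fin sqr_ge0.
apply: (real_llr_sq_lty (hf j.1 (j.1 \in A)) (hf j.1 (~~ (j.1 \in A)))); last exact: hvar.
by move=> B mB; exact: (@lawAE (j.1, 0%N)).
Qed.

Lemma mean_gt0 j : (0 < mean j)%R.
Proof.
rewrite -lte_fin -mean_zeta.
apply: (real_llr_mean_gt0 (hf j.1 (j.1 \in A)) (hf j.1 (~~ (j.1 \in A)))).
- exact: lawAE.
- exact: hKL.
- exact: hvar.
Qed.

Lemma second_moment_ge0 j : (0 <= second_moment j)%R.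
Proof.
rewrite -lee_fin -second_moment_zeta; apply: integral_ge0 => x _.
by rewrite lee_fin sqr_ge0.
Qed.

(** A positive lower bound of the means: its inverse exceeds each of theirs. *)
Definition drift : R := ((1 + \sum_k (mean (k, 0%N))^-1)^-1)%R.
Definition sq_bound : R := (\sum_k second_moment (k, 0%N))%R.

Lemma drift_gt0 : (0 < drift)%R.
Proof.
rewrite invr_gt0 ltr_pwDl// sumr_ge0// => k _.
by rewrite invr_ge0 ltW// mean_gt0.
Qed.

Lemma drift_le_mean j : (drift <= mean j)%R.
Proof.
rewrite -[leRHS]invrK lef_pV2 ?posrE ?invr_gt0 ?mean_gt0//; last first.
  by rewrite -invr_gt0 drift_gt0.
rewrite -[leLHS]add0r lerD// (bigD1 j.1)//= lerDl sumr_ge0// => k _.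
by rewrite invr_ge0 ltW// mean_gt0.
Qed.

Lemma second_moment_le j : (second_moment j <= sq_bound)%R.
Proof.
rewrite /sq_bound (bigD1 j.1)//= lerDl sumr_ge0// => k _; exact: second_moment_ge0.
Qed.

Definition llr_walk (t : nat) (k : 'I_K) (w : Omega) : R :=
  walk obs (fun j => zeta (j := j)) t k w.

Definition regular_path : set Omega := [set w | forall k s, @regular k (X k s w)].

Lemma regular_path_ae : (P A).-negligible (~` regular_path).
Proof.
pose bad k s := X k s @^-1` (~` @regular k).
have mpos k : measurable (~` @regular k).
  apply: measurableC; exact: (measurable_both_pos (hf k (k \in A)) (hf k (~~ (k \in A)))).
have mbad k s : measurable (bad k s).
  exact: (measurable_obs_preimage (@measurable_obs) (i := (k, s)) (mpos k)).
have bad0 k s : (P A).-negligible (bad k s).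
  apply/negligibleP => //.
  exact: (both_pos_ae (hf k (k \in A)) (hf k (~~ (k \in A))) (@lawAE (k, s)) (hvar k (k \in A))).
pose badn n := oapp (fun ks : I => bad ks.1 ks.2) set0 (choice.unpickle n).
apply: (@negligibleS _ _ _ _ (\bigcup_n badn n)); last first.
  apply: negligible_bigcup => n; rewrite /badn; case: choice.unpickle => //=.
  exact: negligible_set0.
move=> w /=; apply: contra_notP => h k s; apply: contrapT => np.
by apply: h; exists (choice.pickle (k, s)) => //; rewrite /badn choice.pickleK.
Qed.

Definition past_event t := <<s obs_gen obs [set` past t] >>.

Lemma filtrationE t : filtration X t = past_event t.
Proof.
rewrite /filtration /past_event; congr (<<s _ >>); apply/seteqP; split.
  move=> _ [k [s [B [st mB ->]]]]; exists (k, s), B; split => //.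
  by rewrite /= in_past.
move=> E [[k s] [B [/= + mB ->]]]; rewrite in_past /= => st.
by exists k, s, B.
Qed.

Lemma prod_past t (F : I -> R) :
  (\prod_(j <- past t) F j = \prod_(k < K) \prod_(0 <= s < t) F (k, s))%R.
Proof.
rewrite (perm_big [seq (k, s) | k <- enum 'I_K, s <- iota 0 t])/=.
  rewrite big_allpairs big_enum /=.
  by apply: eq_bigr => k _; rewrite /index_iota subn0.
apply: uniq_perm; first exact: fset_uniq.
  apply: allpairs_uniq; [exact: enum_uniq|exact: iota_uniq|].
  by move=> [k s] [k' s'] _ _ /= ->.
by move=> j; rewrite !inE.
Qed.

(** The integrand is the likelihood ratio of P B to P A at time t: the streams
    outside the symmetric difference have the same law under both. *)
Lemma likelihood_le (B : {set 'I_K}) t (G : set Omega) : past_event t G ->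
  \int[P A]_(w in G) (expR (- \sum_(k in symd A B) llr_walk t k w))%:E <= P B G.
Proof.
move=> mG.
pose ell (j : I) (x : S j.1) : R :=
  if j.1 \in symd A B then expR (- zeta (j := j) x) else 1%R.
pose pos (j : I) : set (S j.1) := if j.1 \in symd A B then @regular j.1 else setT.
have mz j : measurable_fun setT (zeta (j := j)).
  exact: (measurable_real_llr (hf j.1 (j.1 \in A)) (hf j.1 (~~ (j.1 \in A)))).
have mell j : measurable_fun setT (@ell j).
  rewrite /ell; case: (j.1 \in symd A B) => //.
  by apply: measurableT_comp => //; exact: measurableT_comp.
have ell0 j x : (0 <= @ell j x)%R by rewrite /ell; case: ifP => _ //; exact: expR_ge0.
have mpos j : measurable (@pos j).
  rewrite /pos; case: (j.1 \in symd A B) => //.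
  exact: (measurable_both_pos (hf j.1 (j.1 \in A)) (hf j.1 (~~ (j.1 \in A)))).
have symdE k : k \in symd A B -> (k \in B) = ~~ (k \in A).
  by rewrite !inE; case: (k \in A); case: (k \in B).
have nsymdE k : k \notin symd A B -> (k \in B) = (k \in A).
  by rewrite !inE; case: (k \in A); case: (k \in B).
have ellE j (C : set (S j.1)) : measurable C ->
    \int[P A]_(w in obs j @^-1` C) (@ell j (obs j w))%:E =
    P B (obs j @^-1` (C `&` @pos j)).
  move=> mC.
  transitivity (\int[lawA j]_(x in C) (@ell j x)%:E).
    rewrite ge0_integral_pushforward//.
      by apply/measurable_EFinP; exact: measurable_funTS.
    by move=> x _; rewrite lee_fin.
  rewrite marginal_density; last exact: measurableI.
  rewrite /ell /pos; case: ifPn => js.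
    rewrite symdE//.
    apply: (real_llr_likelihood (hf j.1 (j.1 \in A)) (hf j.1 (~~ (j.1 \in A)))) => //.
    exact: lawAE.
  rewrite integral_cst// mul1e setIT nsymdE//; exact: lawAE.
have LR := likelihood_ratio (@measurable_obs) (indep_obs A) (indep_obs B)
  mell ell0 mpos ellE mG.
apply: (@le_trans _ _ (P B (G `&` cylinder obs (past t) pos))).
  rewrite -LR le_eqVlt; apply/orP; left; apply/eqP.
  apply: eq_integral => w _; congr _%:E.
  rewrite prod_past [RHS](bigID (fun k => k \in symd A B)) /=.
  rewrite [X in _ = (_ * X)%R]big1 ?mulr1; last first.
    by move=> k ks; rewrite big1// => s _; rewrite /ell (negbTE ks).
  rewrite -sumrN expR_sum; apply: eq_bigr => k ks.
  rewrite /llr_walk /walk -sumrN expR_sum; apply: eq_bigr => s _.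
  by rewrite /ell ks.
apply: le_measure; rewrite ?inE; last by move=> w [].
- apply: measurableI; first exact: (measurable_obs_event (@measurable_obs) mG).
  exact: (measurable_cylinder (@measurable_obs)).
- exact: (measurable_obs_event (@measurable_obs) mG).
Qed.

Lemma lambdaE w n k : regular_path w ->
  lambda f X w n k = (if k \in A then llr_walk n k w else - llr_walk n k w)%:E.
Proof.
move=> gw; rewrite /lambda /llr_walk /walk /zeta /obs /=.
have := gw k; rewrite /regular; case: (k \in A) => /= gk.
  by rewrite -sumEFin; apply: eq_bigr => s _; rewrite llr_finite.
rewrite -sumrN -sumEFin; apply: eq_bigr => s _; have [h1 h0] := gk s.
rewrite llr_finite; last by split.
by rewrite !real_llrE ?opprB; split.
Qed.

(** The set of the streams with a positive log-likelihood ratio is at least as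
    likely as A, so deficits measured from A are lower bounds for those of
    [leap_stops]. *)
Lemma leap_le w n m1 m2 (a b : R) (D : {set 'I_K}) : regular_path w ->
  (0 < n)%N -> (0 < m1)%N -> (0 < m2)%N -> (0 < a)%R -> (0 < b)%R ->
  (forall B : {set 'I_K}, (m1 <= #|D :\: B|)%N ->
     (b <= \sum_(k in symd A B) llr_walk n k w)%R) ->
  (forall B : {set 'I_K}, (m2 <= #|B :\: D|)%N ->
     (a <= \sum_(k in symd A B) llr_walk n k w)%R) ->
  time_le (leap_time m1 m2 a b (lambda f X w)) n.
Proof.
move=> gw n0 m10 m20 a0 b0 Hb Ha.
pose v k := (if k \in A then llr_walk n k w else - llr_walk n k w)%R.
set Sg := [set k | (0 < v k)%R]%SET.
have key (B : {set 'I_K}) : (\sum_(k in symd A B) llr_walk n k w <=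
    \sum_(k in (Sg :\: B) :|: (B :\: Sg)) `|v k|)%R.
  rewrite big_mkcond [leRHS]big_mkcond; apply: ler_sum => k _.
  rewrite !inE /v; case: (k \in A); case: (k \in B) => /=;
   case: (ltrP 0%R _) => /= h; rewrite ?normrN ?ler_norm//.
  by rewrite -oppr_ge0 ltW.
apply: (@leap_stops R K m1 m2 a b v (lambda f X w) n D) => //.
- by move=> k; rewrite lambdaE.
- by move=> B /Hb h; exact: le_trans h (key B).
- by move=> B /Ha h; exact: le_trans h (key B).
Qed.

(** * Delays of the Leap rule *)

(** The width H of the transition zone required by [huber_drift]; the added 1
    keeps it positive. *)
Definition width : R := (K%:R * sq_bound / drift + 1)%R.

Lemma sq_bound_ge0 : (0 <= sq_bound)%R.
Proof. by apply: sumr_ge0 => k _; exact: second_moment_ge0. Qed.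

Lemma width_gt0 : (0 < width)%R.
Proof.
rewrite ltr_wpDl// divr_ge0 ?(ltW drift_gt0)//.
by rewrite mulr_ge0// sq_bound_ge0.
Qed.

Lemma width_large : (K%:R * sq_bound <= drift * width)%R.
Proof.
rewrite /width mulrDr mulr1 [(drift * _)%R]mulrC divfK ?gt_eqF ?drift_gt0//.
by rewrite lerDl ltW// drift_gt0.
Qed.

Lemma symd_neq0 (B : {set 'I_K}) : A != B -> exists k, k \in symd A B.
Proof.
move=> AB; apply/set0Pn; apply: contraNneq AB => /eqP.
rewrite finset.setU_eq0 !finset.setD_eq0 => /andP[h1 h2].
by rewrite finset.eqEsubset h1 h2.
Qed.

Lemma sum_symd_ge (g : 'I_K -> R) (y : R) (B : {set 'I_K}) : A != B ->
  (0 <= y)%R -> (forall k, y <= g k)%R -> (y <= \sum_(k in symd A B) g k)%R.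
Proof.
move=> /symd_neq0[k0 k0s] y0 yg; rewrite (bigD1 k0)//=.
rewrite -[leLHS]addr0 lerD// sumr_ge0// => k _; exact: le_trans (yg k).
Qed.

Definition late (y : R) (n0 n : nat) : set Omega :=
  unpassed obs (fun j => zeta (j := j)) setT (fun _ _ => y) n0 n.

Lemma measurable_llr_walk t k :
  measurable_fun setT (llr_walk t k : obs_field obs [set` past t] -> R).
Proof. exact: (measurable_walk integrable_zeta). Qed.

Lemma unpassed_sum_model (G : set Omega) (Y : 'I_K -> Omega -> R) t : past_event t G ->
  (forall k, measurable_fun setT (Y k : obs_field obs [set` past t] -> R)) ->
  (drift / 2)%:E *
    \sum_(n <oo) P A (unpassed obs (fun j => zeta (j := j)) G Y t (t + n)) <=
  \int[P A]_(w in G) (\sum_(k < K) huber width (Y k w - llr_walk t k w))%:E.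
Proof.
move=> mG mY.
exact: (unpassed_sum (indep_obs A) integrable_zeta mean_zeta second_moment_zeta drift_gt0
  drift_le_mean second_moment_le width_gt0 width_large).
Qed.

Lemma measurable_unpassed_model (G : set Omega) (Y : 'I_K -> Omega -> R) t n : (t <= n)%N ->
  past_event t G -> (forall k, measurable_fun setT (Y k : obs_field obs [set` past t] -> R)) ->
  measurable (unpassed obs (fun j => zeta (j := j)) G Y t n).
Proof.
move=> tn mG mY; apply: (measurable_obs_event (@measurable_obs) (J := [set` past n])).
exact: (measurable_unpassed integrable_zeta).
Qed.

Lemma measurable_late y n0 n : (n0 <= n)%N -> measurable (late y n0 n).
Proof.
move=> n0n; apply: measurable_unpassed_model => //.
exact: (@measurableT _ (obs_field obs [set` past n0])).
Qed.

Definition late_cost : R := ((drift / 2)^-1 * (K%:R * (sq_bound / (2 * drift))))%R.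

Lemma late_sum_le (y : R) (n0 : nat) : (0 < n0)%N -> (2 * (y + width) <= drift * n0%:R)%R ->
  \sum_(n <oo) P A (late y n0 (n0 + n)) <= late_cost%:E.
Proof.
move=> n00 yn0.
have c0 : (0 < drift / 2)%R by rewrite divr_gt0// drift_gt0.
rewrite /late_cost EFinM lee_pdivlMl//.
have := unpassed_sum_model (t := n0) (G := setT) (Y := fun _ _ => y).
move=> h; apply: (le_trans (h _ _)).
- exact: (@measurableT _ (obs_field obs [set` past n0])).
- by move=> k.
exact: (huber_tail_le (indep_obs A) integrable_zeta mean_zeta second_moment_zeta
  drift_gt0 drift_le_mean second_moment_le width_gt0 n00 yn0).
Qed.

(** Once all walks are above both thresholds, A itself is a decision that satisfies
    the criterion of [leap_le]. *)
Lemma leap_above w n m1 m2 (a b y : R) : regular_path w ->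
  (0 < n)%N -> (0 < m1)%N -> (0 < m2)%N -> (0 < a <= y)%R -> (0 < b <= y)%R ->
  (forall k, y <= llr_walk n k w)%R ->
  time_le (leap_time m1 m2 a b (lambda f X w)) n.
Proof.
move=> gw n0 m10 m20 /andP[a0 a_le_y] /andP[b0 b_le_y] yS.
have y0 : (0 <= y)%R by apply: le_trans a_le_y; exact: ltW.
apply: (@leap_le w n m1 m2 a b A) => //.
- move=> B mB; apply: (le_trans b_le_y); apply: sum_symd_ge => //.
  by apply: contraTneq mB => <-; rewrite finset.setDv cards0 -ltnNge.
- move=> B mB; apply: (le_trans a_le_y); apply: sum_symd_ge => //.
  by apply: contraTneq mB => <-; rewrite finset.setDv cards0 -ltnNge.
Qed.

Lemma leap_time_le w n0 m1 m2 (a b y : R) : regular_path w ->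
  (0 < n0)%N -> (0 < m1)%N -> (0 < m2)%N -> (0 < a <= y)%R -> (0 < b <= y)%R ->
  time_ereal R (leap_time m1 m2 a b (lambda f X w)) <=
  n0%:R%:E + \sum_(n <oo) (\1_(late y n0 (n0 + n)) w)%:E.
Proof.
move=> gw n00 m10 m20 ha hb; apply: time_ereal_le => n.
  by rewrite lee_fin.
move=> nT; rewrite indicE mem_set//; split => // j /andP[n0j jn].
apply: contrapT => h; move/negP: nT; apply.
have : time_le (leap_time m1 m2 a b (lambda f X w)) j.
  apply: (@leap_above w j m1 m2 a b y) => //; first exact: leq_trans n0j.
  by move=> k; rewrite leNgt; apply/negP => ?; apply: h; exists k.
by case: leap_time => //= s sj; exact: leq_trans jn.
Qed.

(** If D is an error for B, the risk r of stopping at t with D bounds the likelihood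
    ratio exp (- S_t) by e * r, with e = alpha or beta. As log r <= r, this gives
    S_t >= |log e| - r, and the gain c0 + r of a single walk of the symmetric
    difference is enough to bring S_n above |log e| + c0. *)
Lemma leap_after_risk w t n m1 m2 (al be c0 r a b : R) (D : {set 'I_K}) : regular_path w ->
  (0 < t)%N -> (t <= n)%N -> (0 < m1)%N -> (0 < m2)%N ->
  (0 < al < 1)%R -> (0 < be < 1)%R -> (0 < a <= `|ln be| + c0)%R ->
  (0 < b <= `|ln al| + c0)%R -> (0 <= c0)%R -> (0 <= r)%R ->
  (#|D :\: A| < m1)%N -> (#|A :\: D| < m2)%N ->
  (forall B : {set 'I_K}, (m1 <= #|D :\: B|)%N ->
     expR (- \sum_(k in symd A B) llr_walk t k w) * al^-1 <= r)%R ->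
  (forall B : {set 'I_K}, (m2 <= #|B :\: D|)%N ->
     expR (- \sum_(k in symd A B) llr_walk t k w) * be^-1 <= r)%R ->
  (forall k, c0 + r + llr_walk t k w <= llr_walk n k w)%R ->
  time_le (leap_time m1 m2 a b (lambda f X w)) n.
Proof.
move=> gw t0 tn m10 m20 al01 be01 /andP[a0 ac] /andP[b0 bc] c00 r0 DA AD h1 h2 h3.
have key (e : R) (B : {set 'I_K}) : (0 < e < 1)%R -> A != B ->
    (expR (- \sum_(k in symd A B) llr_walk t k w) * e^-1 <= r)%R ->
    (`|ln e| + c0 <= \sum_(k in symd A B) llr_walk n k w)%R.
  move=> /andP[e0 e1] AB h.
  have lnh : (`|ln e| - \sum_(k in symd A B) llr_walk t k w <= r)%R.
    apply: le_trans h; rewrite -[in leRHS](lnK (x := e)) ?posrE// -expRN -expRD.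
    rewrite ltr0_norm; last by rewrite ln_lt0// e0 e1.
    apply: le_trans (expR_ge1Dx _); lra.
  have : (c0 + r <= \sum_(k in symd A B) (llr_walk n k w - llr_walk t k w))%R.
    apply: sum_symd_ge => //; first exact: addr_ge0.
    by move=> k; rewrite lerBrDr.
  rewrite big_split/= sumrN; lra.
apply: (@leap_le w n m1 m2 a b D) => //; first exact: leq_trans tn.
- move=> B mB; apply: (le_trans bc); apply: key => //; last exact: h1.
  by apply: contraTneq mB => <-; rewrite -ltnNge.
- move=> B mB; apply: (le_trans ac); apply: key => //; last exact: h2.
  by apply: contraTneq mB => <-; rewrite -ltnNge.
Qed.

(** * Comparison with an arbitrary procedure *)

Section procedure.
Context (m1 m2 : nat) (al be : R) (p : procedure K Omega).
Hypothesis hm1 : (0 < m1 <= K)%N.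
Hypothesis hm2 : (0 < m2 <= K)%N.
Hypothesis al01 : (0 < al < 1)%R.
Hypothesis be01 : (0 < be < 1)%R.
Hypothesis hp : Delta_gfr P X m1 m2 al be p.

Let T := p.1.
Let D := p.2.

Definition stopped_with (t : nat) (q : pred {set 'I_K}) : set Omega :=
  [set w | T w = Some t /\ q (D w)].

Lemma measurable_decision (q : pred {set 'I_K}) : measurable [set w | q (D w)].
Proof.
rewrite (_ : [set w | _] = \bigcup_(B in [set B | q B]) [set w | D w = B]).
  apply: fin_bigcup_measurable => // B _.
  case: hp => -[_ /(_ B)[h _]] _ _; move: h; apply: smallest_sub.
    exact: sigma_algebra_measurable.
  move=> E [t _]; rewrite filtrationE => mE.
  exact: (measurable_obs_event (@measurable_obs) mE).
by apply/seteqP; split=> w /= => [qD|[B /= qB ->]//]; exists (D w).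
Qed.

Lemma stop_le_past_event t : past_event t [set w | time_le (T w) t].
Proof.
case: hp => -[[T0 hT] _] _ _; case: t => [|t].
  rewrite (_ : [set w | _] = set0); first exact: (@measurable0 _ (obs_field obs [set` past 0])).
  apply/seteqP; split=> w //=; have := T0 w; rewrite /T; case: (p.1 w) => //= s.
  by rewrite leqn0 => + /eqP s0; rewrite s0.
by rewrite -filtrationE; exact: hT.
Qed.

Lemma stopped_with_past_event t q : past_event t (stopped_with t q).
Proof.
case: hp => -[[T0 hT] hD] _ _; case: t => [|t].
  rewrite (_ : stopped_with 0 q = set0); first
    exact: (@measurable0 _ (obs_field obs [set` past 0])).
  by apply/seteqP; split=> w //= -[/T0].
rewrite (_ : stopped_with t.+1 q = (\bigcup_(B in [set B | q B])
    ([set w | D w = B] `&` [set w | time_le (T w) t.+1])) `\` [set w | time_le (T w) t]).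
  apply: (@measurableD _ (obs_field obs [set` past t.+1])).
    apply: (@fin_bigcup_measurable _ (obs_field obs [set` past t.+1])) => // B _.
    have := (hD B).2 t.+1 isT; rewrite filtrationE; exact.
  exact: (past_event_mono (leqnSn t) (@stop_le_past_event t)).
apply/seteqP; split=> w /=.
  move=> [Tw qD]; split; last by rewrite Tw /= ltnn.
  by exists (D w) => //; split => //=; rewrite Tw /=.
move=> [[B /= qB [DB +]]]; rewrite /stopped_with/= DB; case: (T w) => //= s st.
move=> /negP; rewrite -ltnNge => ts.
by split => //; congr Some; apply/eqP; rewrite eqn_leq st.
Qed.

Lemma measurable_stopped_with t q : measurable (stopped_with t q).
Proof. exact: (measurable_obs_event (@measurable_obs) (@stopped_with_past_event t q)). Qed.

Lemma stopped_with_sum_le (Q : probability Omega R) q :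
  \sum_(t <oo) Q (stopped_with t q) <= Q [set w | q (D w)].
Proof.
rewrite [leLHS](_ : _ = Q (\bigcup_t stopped_with t q)).
  apply: le_measure; rewrite ?inE; last by move=> w [t _ []].
    by apply: bigcupT_measurable => t; exact: measurable_stopped_with.
  exact: measurable_decision.
rewrite measure_bigcup//; last 2 first.
- by move=> t _; exact: measurable_stopped_with.
- apply/trivIsetP => t t' _ _ /eqP tt'; apply/seteqP; split=> // w [[Tt _] [Tt' _]].
  by move: Tt'; rewrite Tt => -[].
by apply: eq_eseriesl => t; rewrite in_setT.
Qed.

Definition false_positives (B : {set 'I_K}) : pred {set 'I_K} := fun d => (m1 <= #|d :\: B|)%N.
Definition false_negatives (B : {set 'I_K}) : pred {set 'I_K} := fun d => (m2 <= #|B :\: d|)%N.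
Definition acceptable : pred {set 'I_K} :=
  fun d => ~~ false_positives A d && ~~ false_negatives A d.

Definition lratio t B w : R := expR (- \sum_(k in symd A B) llr_walk t k w)%R.

(** The risk of stopping at time t: a set B weighs as much as its likelihood ratio
    to A, and an error as much as the inverse of its tolerated probability. The
    indicators make it vanish off the event that T = t and keep it measurable
    with respect to the observations up to time t. *)
Definition risk t w : R :=
  (\sum_(B : {set 'I_K}) lratio t B w *
     (al^-1 * \1_(stopped_with t (false_positives B)) w +
      be^-1 * \1_(stopped_with t (false_negatives B)) w))%R.

Lemma al_gt0 : (0 < al)%R. Proof. by case/andP: al01. Qed.
Lemma be_gt0 : (0 < be)%R. Proof. by case/andP: be01. Qed.

Lemma risk_term_ge0 t B w : (0 <= lratio t B w *
     (al^-1 * \1_(stopped_with t (false_positives B)) w +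
      be^-1 * \1_(stopped_with t (false_negatives B)) w))%R.
Proof.
rewrite mulr_ge0 ?expR_ge0// addr_ge0// mulr_ge0// invr_ge0 ltW//.
- exact: al_gt0.
- exact: be_gt0.
Qed.

Lemma risk_ge0 t w : (0 <= risk t w)%R.
Proof. by apply: sumr_ge0 => B _; exact: risk_term_ge0. Qed.

Lemma measurable_lratio t B : measurable_fun setT (lratio t B : obs_field obs [set` past t] -> R).
Proof.
apply: measurableT_comp => //; apply: measurableT_comp => //.
rewrite (_ : (fun w => _) = fun w => (\sum_(k <- enum (symd A B)) llr_walk t k w)%R).
  by apply: measurable_sum => k; exact: measurable_llr_walk.
by apply/funext => w; rewrite big_enum.
Qed.

Lemma measurable_risk_term t B : measurable_fun setT
  ((fun w => lratio t B w * (al^-1 * \1_(stopped_with t (false_positives B)) w +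
      be^-1 * \1_(stopped_with t (false_negatives B)) w))%R
    : obs_field obs [set` past t] -> R).
Proof.
apply: measurable_funM; first exact: measurable_lratio.
apply: measurable_funD; apply: measurable_funM => //.
  by apply: (@measurable_indic _ (obs_field obs [set` past t])); exact: stopped_with_past_event.
by apply: (@measurable_indic _ (obs_field obs [set` past t])); exact: stopped_with_past_event.
Qed.

Lemma measurable_risk t : measurable_fun setT (risk t : obs_field obs [set` past t] -> R).
Proof. by apply: measurable_sum => B; exact: measurable_risk_term. Qed.

Lemma risk_integral_le t : \int[P A]_w (risk t w)%:E <=
  \sum_(B : {set 'I_K}) (al^-1%:E * P B (stopped_with t (false_positives B)) +
     be^-1%:E * P B (stopped_with t (false_negatives B))).
Proof.
have mLR B : measurable_fun setT (lratio t B).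
  exact: (measurable_obs_field (@measurable_obs) (@measurable_lratio t B)).
have mterm B q : measurable_fun setT (fun w => (lratio t B w * \1_(stopped_with t q) w)%:E).
  apply/measurable_EFinP; apply: measurable_funM => //.
  by apply: measurable_indic; exact: measurable_stopped_with.
have term B q : \int[P A]_w (lratio t B w * \1_(stopped_with t q) w)%:E <= P B (stopped_with t q).
  apply: (le_trans _ (@likelihood_le B t _ (@stopped_with_past_event t q))).
  rewrite [leRHS]integral_mkcond le_eqVlt; apply/orP; left; apply/eqP.
  apply: eq_integral => w _; rewrite patchE indicE.
  by case: (w \in _); rewrite ?mulr1 ?mulr0.
under eq_integral => w _ do rewrite /risk -sumEFin.
rewrite ge0_integral_sum//; last 2 first.
- move=> B; apply/measurable_EFinP.
  exact: (measurable_obs_field (@measurable_obs) (@measurable_risk_term t B)).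
- by move=> B w _; rewrite lee_fin risk_term_ge0.
have ali := invr_gt0 al; rewrite al_gt0 in ali.
have bei := invr_gt0 be; rewrite be_gt0 in bei.
apply: lee_sum => B _.
under eq_integral => w _.
  rewrite mulrDr mulrCA [X in (_ + X)%R]mulrCA EFinD !EFinM.
  rewrite -(EFinM (lratio t B w)) -(EFinM (lratio t B w)). over.
rewrite ge0_integralD//; last 4 first.
- by move=> w _; rewrite mule_ge0 ?lee_fin ?mulr_ge0 ?expR_ge0// ltW.
- exact: emeasurable_funM.
- by move=> w _; rewrite mule_ge0 ?lee_fin ?mulr_ge0 ?expR_ge0// ltW.
- exact: emeasurable_funM.
rewrite !ge0_integralZl//; last 4 first.
- by move=> w _; rewrite lee_fin mulr_ge0 ?expR_ge0.
- by rewrite lee_fin ltW.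
- by move=> w _; rewrite lee_fin mulr_ge0 ?expR_ge0.
- by rewrite lee_fin ltW.
by apply: leeD; apply: lee_wpmul2l => //; rewrite lee_fin ltW.
Qed.

(** A change of measure for each B, then the error constraints: each set B
    contributes at most alpha / alpha + beta / beta. *)
Lemma risk_sum_le : \sum_(t <oo) \int[P A]_w (risk t w)%:E <=
  (2 * #|{set 'I_K}|%:R)%:E.
Proof.
have ali := invr_gt0 al; rewrite al_gt0 in ali.
have bei := invr_gt0 be; rewrite be_gt0 in bei.
apply: (@le_trans _ _ (\sum_(t <oo) \sum_(B : {set 'I_K})
    (al^-1%:E * P B (stopped_with t (false_positives B)) +
     be^-1%:E * P B (stopped_with t (false_negatives B))))).
  apply: lee_nneseries => [t _ _|t _]; last exact: risk_integral_le.
  by apply: integral_ge0 => w _; rewrite lee_fin risk_ge0.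
rewrite nneseries_sum; last first.
  by move=> B t _; rewrite adde_ge0// mule_ge0// lee_fin ltW.
rewrite (_ : (2 * #|{set 'I_K}|%:R)%:E = \sum_(B : {set 'I_K}) (2%:E : \bar R)); last first.
  by rewrite sumEFin sumr_const mulr_natr.
apply: lee_sum => B _.
rewrite nneseriesD; last 2 first.
- by move=> t _ _; rewrite mule_ge0// lee_fin ltW.
- by move=> t _ _; rewrite mule_ge0// lee_fin ltW.
rewrite !nneseriesZl ?(ltW ali) ?(ltW bei)//.
rewrite (_ : 2%:E = 1%:E + 1%:E :> \bar R); last by rewrite -EFinD.
case: hp => _ h1 h2; apply: leeD.
- rewrite lee_pdivrMl ?al_gt0// mule1; apply: le_trans (h1 B); exact: stopped_with_sum_le.
- rewrite lee_pdivrMl ?be_gt0// mule1; apply: le_trans (h2 B); exact: stopped_with_sum_le.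
Qed.

Section bound.
Context (c0 : R).
Hypothesis c00 : (0 <= c0)%R.

(** By [leap_after_risk] the Leap rule has stopped when all walks are above these
    levels. *)
Definition target t (k : 'I_K) w : R := (c0 + risk t w + llr_walk t k w)%R.
Definition waiting t n : set Omega :=
  unpassed obs (fun j => zeta (j := j)) (stopped_with t acceptable) (target t) t n.

Lemma measurable_target t k : measurable_fun setT (target t k : obs_field obs [set` past t] -> R).
Proof.
apply: measurable_funD; last exact: measurable_llr_walk.
by apply: measurable_funD => //; exact: measurable_risk.
Qed.

Lemma measurable_waiting t n : (t <= n)%N -> measurable (waiting t n).
Proof.
move=> tn; apply: measurable_unpassed_model => //; first exact: stopped_with_past_event.
by move=> k; exact: measurable_target.
Qed.

(** At time t the deficits are all equal to c0 + risk t, where the Huber function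
    is affine. *)
Lemma waiting_sum_at_le t : (drift / 2)%:E * \sum_(n <oo) P A (waiting t (t + n)) <=
  (K%:R * (c0 + width / 2))%:E * P A (stopped_with t acceptable) +
  K%:R%:E * \int[P A]_w (risk t w)%:E.
Proof.
apply: (le_trans (unpassed_sum_model (stopped_with_past_event acceptable) (@measurable_target t))).
have mrt : measurable_fun setT (fun w => (risk t w)%:E).
  by apply/measurable_EFinP; exact: (measurable_obs_field (@measurable_obs) (@measurable_risk t)).
have k0 : (0 <= K%:R * (c0 + width / 2))%R.
  by rewrite mulr_ge0// addr_ge0// divr_ge0// ltW// width_gt0.
apply: (@le_trans _ _ (\int[P A]_(w in stopped_with t acceptable)
    ((K%:R * (c0 + width / 2))%:E + K%:R%:E * (risk t w)%:E))).
  apply: ge0_le_integral_nomeas => w _.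
    by rewrite lee_fin sumr_ge0// => k _; rewrite huber_ge0// width_gt0.
  rewrite -EFinM -EFinD lee_fin.
  rewrite (eq_bigr (fun=> (c0 + risk t w + width / 2)%R)).
    rewrite sumr_const card_ord -mulr_natl -mulrDr; nra.
  by move=> k _; rewrite /target addrK huberE_ge0 ?width_gt0// addr_ge0// risk_ge0.
rewrite ge0_integralD//; last 3 first.
- exact: measurable_stopped_with.
- by move=> w _; rewrite mule_ge0// lee_fin risk_ge0.
- by apply: measurable_funTS; exact: emeasurable_funM.
rewrite integral_cst; last exact: measurable_stopped_with.
apply: leeD => //; rewrite ge0_integralZl//; last 3 first.
- exact: measurable_stopped_with.
- exact: measurable_funTS.
- by move=> w _; rewrite lee_fin risk_ge0.
rewrite lee_wpmul2l ?lee_fin//; apply: ge0_subset_integral => //.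
- exact: measurable_stopped_with.
- by move=> w _; rewrite lee_fin risk_ge0.
Qed.

Definition waiting_cost : R := ((drift / 2)^-1 * (K%:R * (c0 + width / 2) +
  K%:R * (2 * #|{set 'I_K}|%:R)))%R.

Lemma waiting_sum_le : \sum_(t <oo) \sum_(n <oo) P A (waiting t (t + n)) <= waiting_cost%:E.
Proof.
have mu2 : (0 < drift / 2)%R by rewrite divr_gt0// drift_gt0.
have k0 : (0 <= K%:R * (c0 + width / 2))%R.
  by rewrite mulr_ge0// addr_ge0// divr_ge0// ltW// width_gt0.
have rt0 t : 0 <= \int[P A]_w (risk t w)%:E.
  by apply: integral_ge0 => w _; rewrite lee_fin risk_ge0.
rewrite /waiting_cost EFinM lee_pdivlMl// -nneseriesZl; last first.
  by move=> t _; apply: nneseries_ge0.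
apply: (@le_trans _ _ (\sum_(t <oo) ((K%:R * (c0 + width / 2))%:E * P A (stopped_with t acceptable)
    + K%:R%:E * \int[P A]_w (risk t w)%:E))).
  apply: lee_nneseries => [t _ _|t _]; last exact: waiting_sum_at_le.
  by rewrite mule_ge0 ?lee_fin ?(ltW mu2)//; apply: nneseries_ge0.
rewrite nneseriesD; last 2 first.
- by move=> t _ _; rewrite mule_ge0.
- by move=> t _ _; rewrite mule_ge0// lee_fin.
rewrite !nneseriesZl// EFinD; apply: leeD.
  rewrite -[leRHS]mule1 lee_wpmul2l ?lee_fin//.
  apply: (le_trans (stopped_with_sum_le (P A) acceptable)).
  apply: probability_le1; exact: measurable_decision.
by rewrite [leRHS]EFinM lee_wpmul2l ?lee_fin// risk_sum_le.
Qed.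

Let stop_time w : \bar R := time_ereal R (T w).

Lemma stop_time_ge0 w : 0 <= stop_time w.
Proof. by rewrite /stop_time; case: (T w) => //= t; rewrite lee_fin. Qed.

(** The stopping time takes countably many values. *)
Lemma measurable_stop_time : measurable_fun setT stop_time.
Proof.
have mt t : measurable [set w | T w = Some t].
  rewrite (_ : [set w | _] = stopped_with t xpredT); first exact: measurable_stopped_with.
  by apply/seteqP; split=> w //= -[].
move=> _ E mE; rewrite setTI.
rewrite (_ : stop_time @^-1` E = \bigcup_(t in [set t | E t%:R%:E]) [set w | T w = Some t]
  `|` (if `[< E +oo >] then ~` (\bigcup_t [set w | T w = Some t]) else set0)).
  apply: measurableU; first by apply: bigcup_measurable => t _; exact: mt.
  case: ifP => _ //; apply: measurableC; exact: bigcupT_measurable.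
apply/seteqP; split=> w /=; rewrite /stop_time.
  case TE : (T w) => [t|] /= h; first by left; exists t.
  by right; rewrite asboolT// => -[t _]; rewrite /= TE.
case=> [[t Et_ ->]//|]; case: asboolP => // h nT.
by case TE : (T w) => [t|] //=; exfalso; apply: nT; exists t.
Qed.

Section leap_bound.
Context (a b : R) (n0 : nat).
Let y := (a + b)%R.
Hypothesis ha : (0 < a <= `|ln be| + c0)%R.
Hypothesis hb : (0 < b <= `|ln al| + c0)%R.
Hypothesis n00 : (0 < n0)%N.
Hypothesis yn0 : (2 * (y + width) <= drift * n0%:R)%R.

Let TL w : \bar R := time_ereal R (leap_time m1 m2 a b (lambda f X w)).
Let Gw : set Omega := [set w | false_positives A (D w)] `|` [set w | false_negatives A (D w)].
Let FG w : \bar R := n0%:R%:E * (\1_Gw w)%:E.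
Let FW w : \bar R := \sum_(n <oo) (\1_(late y n0 (n0 + n)) w)%:E.
Let FU w : \bar R := \sum_(t <oo) \sum_(n <oo) (\1_(waiting t (t + n)) w)%:E.

Lemma a_le_y : (0 < a <= y)%R.
Proof. by case/andP: ha => a0 _; case/andP: hb => b0 _; rewrite a0 lerDl ltW. Qed.
Lemma b_le_y : (0 < b <= y)%R.
Proof. by case/andP: ha => a0 _; case/andP: hb => b0 _; rewrite b0 lerDr ltW. Qed.

Lemma FU_ge0 w : 0 <= FU w.
Proof. by apply: nneseries_ge0 => t _ _; apply: nneseries_ge0 => n _ _; rewrite lee_fin. Qed.
Lemma FW_ge0 w : 0 <= FW w.
Proof. by apply: nneseries_ge0 => n _ _; rewrite lee_fin. Qed.
Lemma FG_ge0 w : 0 <= FG w.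
Proof. by rewrite mule_ge0// lee_fin. Qed.

(** When T stops with an acceptable decision, the Leap rule stops at the latest when
    the walks reach the targets set at that time. Otherwise Gw occurs, and the
    Leap rule exceeds n0 by the delay of the walks after n0. *)
Lemma leap_pointwise w : regular_path w -> TL w <= stop_time w + (FG w + (FW w + FU w)).
Proof.
move=> gw.
have m10 : (0 < m1)%N by case/andP: hm1.
have m20 : (0 < m2)%N by case/andP: hm2.
rewrite /stop_time; case TE : (T w) => [t|] /=; last first.
  by rewrite addye ?leey// gt_eqF// (lt_le_trans (ltNy0))// !adde_ge0 ?FG_ge0 ?FW_ge0 ?FU_ge0.
have t0 : (0 < t)%N.
  by case: hp => -[[h _] _] _ _; rewrite lt0n; apply/eqP => t0; apply: (h w); rewrite -t0.
have [rD|nrD] := boolP (acceptable (D w)).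
  apply: (@le_trans _ _ (t%:R%:E + \sum_(n <oo) (\1_(waiting t (t + n)) w)%:E)).
    apply: time_ereal_le => n; first by rewrite lee_fin.
    move=> nT; rewrite indicE mem_set//; split => // j /andP[tj jn].
    apply: contrapT => h; move/negP: nT; apply.
    have {h}h k : (c0 + risk t w + llr_walk t k w <= llr_walk j k w)%R.
      by rewrite leNgt; apply/negP => ?; apply: h; exists k.
    have : time_le (leap_time m1 m2 a b (lambda f X w)) j.
      move: (rD); rewrite /acceptable /false_positives /false_negatives -!ltnNge => /andP[dA Ad].
      apply: (@leap_after_risk w t j m1 m2 al be c0 (risk t w) a b (D w)) => //.
      - exact: risk_ge0.
      - move=> B mB; rewrite /risk (bigD1 B)//=; apply: ler_wpDr.
          by apply: sumr_ge0 => B' _; exact: risk_term_ge0.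
        rewrite ler_wpM2l ?expR_ge0// indicE mem_set//= mulr1.
        by apply: ler_wpDr => //; rewrite mulr_ge0// invr_ge0 ltW// be_gt0.
      - move=> B mB; rewrite /risk (bigD1 B)//=; apply: ler_wpDr.
          by apply: sumr_ge0 => B' _; exact: risk_term_ge0.
        rewrite ler_wpM2l ?expR_ge0// [X in (_ <= _ + _ * X)%R]indicE mem_set//= mulr1.
        by apply: ler_wpDl => //; rewrite mulr_ge0// invr_ge0 ltW// al_gt0.
    by case: leap_time => //= s sj; exact: leq_trans jn.
  rewrite leeD2l// -[leLHS]add0e; apply: leeD; first exact: FG_ge0.
  rewrite -[leLHS]add0e; apply: leeD; first exact: FW_ge0.
  have h s : 0 <= \sum_(n <oo) (\1_(waiting s (s + n)) w : R)%:E.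
    by apply: nneseries_ge0 => n _ _; rewrite lee_fin.
  rewrite /FU; apply: le_trans (nneseries_lim_ge t.+1 _); last by move=> s _ _; exact: h.
  by rewrite big_nat_recr//= leeDr// sume_ge0.
have Gww : Gw w.
  by move: nrD; rewrite /acceptable negb_and !negbK => /orP[]; [left|right].
apply: (le_trans (leap_time_le gw n00 m10 m20 a_le_y b_le_y)).
rewrite -[leLHS]add0e; apply: leeD; first by rewrite lee_fin.
apply: leeD; first by rewrite /FG indicE mem_set// mule1.
by rewrite leeDl// FU_ge0.
Qed.

(** [leap_pointwise] holds on regular paths; the function +oo times the indicator
    of a null set covers the other ones. *)
Lemma leap_bound : expected_time (P A) (fun w => leap_time m1 m2 a b (lambda f X w)) <=
  expected_time (P A) T + (n0%:R * (al + be) + (late_cost + waiting_cost))%:E.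
Proof.
have [N [mN N0 gN]] := regular_path_ae.
pose FN w : \bar R := +oo * (\1_N w)%:E.
have FN0 w : 0 <= FN w by rewrite mule_ge0// lee_fin.
have mGw : measurable Gw by apply: measurableU; exact: measurable_decision.
have mi (E : set Omega) : measurable E -> measurable_fun setT (fun w => (\1_E w)%:E : \bar R).
  by move=> mE; apply/measurable_EFinP; exact: measurable_indic.
have mFN : measurable_fun setT FN by apply: emeasurable_funM => //; exact: mi.
have mFG : measurable_fun setT FG by apply: emeasurable_funM => //; exact: mi.
have mFW : measurable_fun setT FW.
  apply: ge0_emeasurable_sum => [n w _ _|n _]; first by rewrite lee_fin.
  by apply: mi; apply: measurable_late; exact: leq_addr.
have mFU1 t : measurable_fun setT (fun w => \sum_(n <oo) (\1_(waiting t (t + n)) w)%:E : \bar R).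
  apply: ge0_emeasurable_sum => [n w _ _|n _]; first by rewrite lee_fin.
  by apply: mi; apply: measurable_waiting; exact: leq_addr.
have mFU : measurable_fun setT FU.
  apply: ge0_emeasurable_sum => [t w _ _|t _]; last exact: mFU1.
  by apply: nneseries_ge0 => n _ _; rewrite lee_fin.
apply: (@le_trans _ _ (\int[P A]_w (stop_time w + (FG w + (FW w + FU w)) + FN w))).
  apply: ge0_le_integral_nomeas => w _.
    by rewrite /TL; case: leap_time => //= s; rewrite lee_fin.
  have [Nw|Nw] := pselect (N w).
    rewrite /FN indicE mem_set// mule1 addey ?leey//.
    by rewrite gt_eqF// (lt_le_trans (ltNy0))// !adde_ge0 ?stop_time_ge0 ?FG_ge0 ?FW_ge0 ?FU_ge0.
  rewrite -[leLHS]adde0; apply: leeD => //; apply: leap_pointwise.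
  by apply: contrapT => ng; apply: Nw; exact: gN.
rewrite ge0_integralD//; last 2 first.
- by move=> w _; rewrite !adde_ge0 ?stop_time_ge0 ?FG_ge0 ?FW_ge0 ?FU_ge0.
- apply: emeasurable_funD; first exact: measurable_stop_time.
  by apply: emeasurable_funD => //; exact: emeasurable_funD.
have PGw : P A Gw <= (al + be)%:E.
  apply: (le_trans (measureU2 _ _ _)); [exact: measurable_decision|exact: measurable_decision|].
  by case: hp => _ h1 h2; rewrite EFinD; apply: leeD; [exact: h1|exact: h2].
rewrite [X in _ + X](_ : _ = 0) ?adde0; last first.
  rewrite ge0_integralZl//; last exact: mi.
  rewrite [X in _ * X](_ : _ = 0) ?mule0//.
  by rewrite integral_indic// setIT; exact: N0.
rewrite ge0_integralD//; last 4 first.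
- by move=> w _; exact: stop_time_ge0.
- exact: measurable_stop_time.
- by move=> w _; rewrite !adde_ge0 ?FG_ge0 ?FW_ge0 ?FU_ge0.
- by apply: emeasurable_funD => //; exact: emeasurable_funD.
rewrite leeD2l// ge0_integralD//; last 3 first.
- by move=> w _; exact: FG_ge0.
- by move=> w _; rewrite !adde_ge0 ?FW_ge0 ?FU_ge0.
- exact: emeasurable_funD.
rewrite EFinD; apply: leeD.
  rewrite ge0_integralZl//; last exact: mi.
  by rewrite integral_indic// setIT EFinM lee_wpmul2l ?lee_fin.
rewrite ge0_integralD//; last 2 first.
- by move=> w _; exact: FW_ge0.
- by move=> w _; exact: FU_ge0.
rewrite EFinD; apply: leeD.
  rewrite integral_nneseries//; last first.
    by move=> n; apply: mi; apply: measurable_late; exact: leq_addr.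
  apply: le_trans (late_sum_le n00 yn0); rewrite le_eqVlt; apply/orP; left; apply/eqP.
  apply: eq_eseriesr => n _; rewrite integral_indic ?setIT//.
  by apply: measurable_late; exact: leq_addr.
rewrite integral_nneseries//; last first.
  by move=> t w _; apply: nneseries_ge0 => n _ _; rewrite lee_fin.
apply: le_trans waiting_sum_le; rewrite le_eqVlt; apply/orP; left; apply/eqP.
apply: eq_eseriesr => t _; rewrite integral_nneseries//; last first.
  by move=> n; apply: mi; apply: measurable_waiting; exact: leq_addr.
apply: eq_eseriesr => n _; rewrite integral_indic ?setIT//.
by apply: measurable_waiting; exact: leq_addr.
Qed.

End leap_bound.

End bound.

End procedure.

(** A finite expected leap time makes its difference with the infimum equal to -oo,
    and not +oo, when the infimum is infinite. *)
Lemma leap_finite m1 m2 (a b : R) (n0 : nat) : (0 < m1)%N -> (0 < m2)%N ->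
  (0 < a)%R -> (0 < b)%R -> (0 < n0)%N -> (2 * (a + b + width) <= drift * n0%:R)%R ->
  expected_time (P A) (fun w => leap_time m1 m2 a b (lambda f X w)) < +oo.
Proof.
move=> m10 m20 a0 b0 n00 yn0.
have [N [mN N0 gN]] := regular_path_ae.
have mi (E : set Omega) : measurable E -> measurable_fun setT (fun w => (\1_E w)%:E : \bar R).
  by move=> mE; apply/measurable_EFinP; exact: measurable_indic.
pose FW w : \bar R := \sum_(n <oo) (\1_(late (a + b) n0 (n0 + n)) w)%:E.
have FW0 w : 0 <= FW w by apply: nneseries_ge0 => n _ _; rewrite lee_fin.
have mFW : measurable_fun setT FW.
  apply: ge0_emeasurable_sum => [n w _ _|n _]; first by rewrite lee_fin.
  by apply: mi; apply: measurable_late; exact: leq_addr.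
have mFN : measurable_fun setT (fun w => +oo * (\1_N w)%:E : \bar R).
  by apply: emeasurable_funM => //; exact: mi.
apply: (@le_lt_trans _ _ (\int[P A]_w (n0%:R%:E + FW w + +oo * (\1_N w)%:E))).
  apply: ge0_le_integral_nomeas => w _; first by case: leap_time => //= s; rewrite lee_fin.
  have [Nw|Nw] := pselect (N w).
    rewrite indicE mem_set// mule1 addey ?leey//.
    by rewrite gt_eqF// (lt_le_trans (ltNy0))// adde_ge0.
  rewrite -[leLHS]adde0; apply: leeD; last by rewrite mule_ge0// lee_fin.
  apply: leap_time_le => //; last by rewrite b0 lerDr ltW.
    by apply: contrapT => ng; apply: Nw; exact: gN.
  by rewrite a0 lerDl ltW.
rewrite ge0_integralD//; last 2 first.
- by move=> w _; rewrite adde_ge0.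
- exact: emeasurable_funD.
rewrite [X in _ + X](_ : _ = 0) ?adde0; last first.
  rewrite ge0_integralZl//; last exact: mi.
  rewrite [X in _ * X](_ : _ = 0) ?mule0//.
  by rewrite integral_indic// setIT; exact: N0.
rewrite ge0_integralD// [X in X + _](_ : _ = n0%:R%:E); last first.
  by rewrite integral_cst//= probability_setT mule1.
rewrite lte_add_pinfty ?ltry//.
rewrite integral_nneseries//; last first.
  by move=> n; apply: mi; apply: measurable_late; exact: leq_addr.
apply: le_lt_trans (ltry late_cost); apply: le_trans (late_sum_le n00 yn0).
rewrite le_eqVlt; apply/orP; left; apply/eqP.
apply: eq_eseriesr => n _; rewrite integral_indic ?setIT//.
by apply: measurable_late; exact: leq_addr.
Qed.

End model.

(** * The asymptotic statement *)

Lemma limf_esup_le (R : realType) (T : choiceType) (X : filteredType T) (g : X -> \bar R)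
    (F : set_system X) (V : set X) (M : \bar R) :
  F V -> (forall x, V x -> g x <= M) -> limf_esup g F <= M.
Proof.
move=> FV gM; rewrite limf_esupE.
apply: (@le_trans _ _ (ereal_sup (g @` V))).
  by apply: ereal_inf_lbound; exists V.
by apply: ge_ereal_sup => _ [x Vx <-]; exact: gM.
Qed.

Lemma mul_abs_ln_le1 (R : realType) (e : R) : (0 < e < 1)%R -> (e * `|ln e| <= 1)%R.
Proof.
move=> /andP[e0 e1]; rewrite ltr0_norm ?ln_lt0 ?e0//.
have := expR_ge1Dx (- ln e); rewrite expRN lnK ?posrE// => h.
rewrite mulrC -ler_pdivlMr// mul1r; apply: le_trans h; lra.
Qed.

Lemma dual_sub_le (R : realType) (x y : \bar R) (M : R) : 0 <= x -> x < +oo ->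
  0 <= y -> x <= y + M%:E -> (x - y)%dE <= M%:E.
Proof.
case: x y => [r| |] [s| |]//= _ _ _; last by rewrite leNye.
by rewrite -EFinD !lee_fin => h; rewrite lerBlDl.
Qed.

Lemma time_ereal_ge0 (R : realType) (o : option nat) : 0 <= time_ereal R o.
Proof. by case: o => //= t; rewrite lee_fin. Qed.

Definition log_count (R : realType) (K m : nat) : R := ln (2 ^ m * 'C(K, m))%N%:R.

Lemma log_count_ge0 (R : realType) (K m : nat) : (m <= K)%N -> (0 <= log_count R K m)%R.
Proof.
move=> mK; rewrite ln_ge0// ler1n muln_gt0 expn_gt0/= bin_gt0//.
Qed.

(** The left-hand side is the horizon times the probability of an unacceptable
    decision. It is bounded because al * |ln al| <= 1, and because al can be
    replaced with C * be, and be with C * al, in the products al * |ln be| and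
    be * |ln al|. *)
Lemma horizon_le (R : realType) (C c mu al be : R) : (0 < C)%R -> (0 <= c)%R -> (0 < mu)%R ->
  (0 < al < 1)%R -> (0 < be < 1)%R -> (C^-1 * al <= be <= C * al)%R ->
  ((Num.truncn (2 * (`|ln be| + `|ln al| + c) / mu)).+1%:R * (al + be) <=
   2 / mu * (2 + 2 * C + 2 * c) + 2)%R.
Proof.
move=> C0 c0 mu_gt0 al01 be01 /andP[h1 h2].
have la := mul_abs_ln_le1 al01; have lb := mul_abs_ln_le1 be01.
case/andP: al01 => a0 a1; case/andP: be01 => b0 b1.
have {}h1 : (al <= C * be)%R by rewrite -ler_pdivrMl.
have x0 : (0 <= 2 * (`|ln be| + `|ln al| + c) / mu)%R.
  by rewrite divr_ge0 ?(ltW mu_gt0)// mulr_ge0// !addr_ge0.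
have s1 : ((`|ln be| + `|ln al|) * (al + be) <= 2 + 2 * C)%R.
  have : (al * `|ln be| <= C)%R.
    apply: le_trans (_ : C * be * `|ln be| <= C)%R; first by rewrite ler_wpM2r.
    by rewrite -mulrA ger_pMr.
  have : (be * `|ln al| <= C)%R.
    apply: le_trans (_ : C * al * `|ln al| <= C)%R; first by rewrite ler_wpM2r.
    by rewrite -mulrA ger_pMr.
  nra.
have s2 : (c * (al + be) <= 2 * c)%R by nra.
apply: (@le_trans _ _ ((2 * (`|ln be| + `|ln al| + c) / mu + 1) * (al + be))%R).
  rewrite ler_wpM2r ?addr_ge0 ?(ltW a0) ?(ltW b0)// -natr1 lerD2r.
  by rewrite truncn_le.
rewrite mulrDl mul1r lerD//; last lra.
rewrite (_ : (2 * (`|ln be| + `|ln al| + c) / mu * (al + be) =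
  2 / mu * ((`|ln be| + `|ln al|) * (al + be) + c * (al + be)))%R); last by ring.
by rewrite ler_wpM2l ?divr_ge0 ?(ltW mu_gt0)// lerD.
Qed.

Theorem theorem5 (R : realType) (K : nat) (hK : (2 <= K)%N)
  (d : 'I_K -> measure_display) (S : forall k, measurableType (d k))
  (mu : forall k, {sigma_finite_measure set (S k) -> \bar R})
  (f : forall k, bool -> S k -> R)
  (hf : forall k i, is_density (mu k) (f k i))
  (dO : measure_display) (Omega : measurableType dO)
  (P : {set 'I_K} -> probability Omega R)
  (X : forall k, nat -> Omega -> S k)
  (hX : iid_streams mu f P X)
  (m1 m2 : nat) (hm1 : (1 <= m1 <= K)%N) (hm2 : (1 <= m2 <= K)%N)
  (hm : (m1 + m2 <= K)%N)
  (hKL : forall k i,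
     0 < \int[mu k]_x (llr (f k i) (f k (~~ i)) x * (f k i x)%:E))
  (hvar : forall k i,
     \int[mu k]_x (llr (f k i) (f k (~~ i)) x ^+ 2 * (f k i x)%:E) < +oo)
  (C : R) (hC : (0 < C)%R) (A : {set 'I_K}) :
  (* dual subtraction: an infinite expected time makes the difference +oo *)
  limf_esup
    (fun p : R * R =>
       (expected_time (P A)
          (leap_rule f X m1 m2 (threshold K m2 p.2) (threshold K m1 p.1)).1
        - Tmin (P A) (Delta_gfr P X m1 m2 p.1 p.2))%dE)
    (within [set p : R * R | [/\ (0 < p.1 < 1)%R, (0 < p.2 < 1)%R
                               & (C^-1 * p.1 <= p.2 <= C * p.1)%R]]
       (nbhs (0%R : R, 0%R : R)))
  < +oo.
Proof.
pose cc m := log_count R K m.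
have cc1 : (0 <= cc m1)%R by apply: log_count_ge0; case/andP: hm1.
have cc2 : (0 <= cc m2)%R by apply: log_count_ge0; case/andP: hm2.
pose c0 : R := (cc m1 + cc m2)%R.
pose H := width hX A; pose nu := drift hX A.
have H0 : (0 < H)%R by apply: width_gt0.
have nu0 : (0 < nu)%R by apply: drift_gt0.
pose M : R := (2 / nu * (2 + 2 * C + 2 * (c0 + H)) + 2 +
  (late_cost hX A + waiting_cost hX A c0))%R.
apply: le_lt_trans (ltry M).
apply: (limf_esup_le (V := [set p : R * R | [/\ (0 < p.1 < 1)%R, (0 < p.2 < 1)%R
                               & (C^-1 * p.1 <= p.2 <= C * p.1)%R]])).
  by apply: nearW.
move=> [al be] /= [al01 be01 alC].
set a := threshold K m2 be; set b := threshold K m1 al.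
have aE : a = (`|ln be| + cc m2)%R by [].
have bE : b = (`|ln al| + cc m1)%R by [].
have lnpos (e : R) : (0 < e < 1)%R -> (0 < `|ln e|)%R.
  by move=> e01; rewrite normr_gt0 lt_eqF// ln_lt0.
have a0 : (0 < a)%R by rewrite aE ltr_pwDl// lnpos.
have b0 : (0 < b)%R by rewrite bE ltr_pwDl// lnpos.
(* the time needed, at speed nu, to climb twice the height a + b + H *)
pose n0 := (Num.truncn (2 * (`|ln be| + `|ln al| + (c0 + H)) / nu)).+1.
have n00 : (0 < n0)%N by [].
have yn0 : (2 * (a + b + H) <= nu * n0%:R)%R.
  rewrite -ler_pdivrMl// mulrC; apply: le_trans (ltW (truncnS_gt _)).
  have nui : (0 <= nu^-1)%R by rewrite invr_ge0; exact: ltW.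
  rewrite ler_wpM2r// aE bE /c0; lra.
case/andP: (hm1) => m10 m1K; case/andP: (hm2) => m20 m2K.
apply: dual_sub_le.
- by apply: integral_ge0 => w _; exact: time_ereal_ge0.
- exact: (leap_finite hf hKL hvar m10 m20 a0 b0 n00 yn0).
- apply: le_ereal_inf_tmp => _ [p _ <-].
  by apply: integral_ge0 => w _; exact: time_ereal_ge0.
rewrite -leeBlDr//; apply: le_ereal_inf_tmp => _ [p hp <-]; rewrite leeBlDr//.
apply: (le_trans (leap_bound hf hKL hvar hm1 hm2 al01 be01 hp (c0 := c0) _ _ _
  n00 yn0)).
- exact: addr_ge0.
- by rewrite a0 aE lerD2l lerDr.
- by rewrite b0 bE lerD2l lerDl.
rewrite leeD2l// lee_fin lerD2r.
apply: horizon_le => //; apply: addr_ge0 (ltW H0); exact: addr_ge0.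
Qed.
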